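(* Let $X$ be an irreducible shift of finite type and $Y$ an irreducible sofic shift. Let $\pi\colon X \to Y$ be a finite-to-one factor code, let $f\colon Y \to \mathbb{R}$ be a potential with summable variation, that is, $f \in \mathrm{SV}(Y)$, and let $\nu$ be a $\sigma$-invariant Gibbs measure for $f$. Then there exists a $\sigma$-invariant Gibbs measure $\mu$ for $f \circ \pi$ with $\pi_* \mu = \nu$.
   Context: A shift space is a closed subset $X\subseteq \mathcal{A}^{\mathbb{Z}}$ ($\mathcal{A}$ a finite discrete alphabet, product topology) that is invariant under the shift $\sigma$, $(\sigma^n x)_0=x_n$. $\mathcal{B}(X)$ is the set of finite words appearing in points of $X$. A shift of finite type is a shift space consisting of all points of $\mathcal{A}^{\mathbb{Z}}$ in which no word from some finite set of forbidden words appears. A factor code $\pi\colon X\to Y$ is a surjective continuous shift-equivariant map between shift spaces; it is finite-to-one if every point of $Y$ has finitely many preimages. A sofic shift is a shift space that is the image of a shift of finite type under a factor code. $X$ is irreducible if for all $u,v\in\mathcal{B}(X)$ there is $w\in\mathcal{B}(X)$ with $uwv\in\mathcal{B}(X)$. All measures are Borel probability measures. Gibbs relation: $\mathfrak{T}_X=\{(x,y)\in X\times X : x_n=y_n \text{ for all } n \text{ with } |n|>N, \text{ for some } N\ge 1\}$. A holonomy of $\mathfrak{T}_X$ is a Borel isomorphism $\psi\colon A\to B$ between Borel sets $A,B\subseteq X$ with $(x,\psi(x))\in\mathfrak{T}_X$ for all $x\in A$. A measure $\mu$ is $\mathfrak{T}_X$-nonsingular if for every Borel $A$ with $\mu(A)=0$,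 the saturation $\mathfrak{T}_X(A)=\{x' : \exists x\in A,\ (x,x')\in\mathfrak{T}_X\}$ has $\mu(\mathfrak{T}_X(A))=0$. A cocycle is a Borel function $\phi\colon\mathfrak{T}_X\to\mathbb{R}$ with $\phi(x,y)+\phi(y,z)=\phi(x,z)$ whenever $(x,y),(y,z)\in\mathfrak{T}_X$. A measure $\mu$ on $X$ is a Gibbs measure for the cocycle $\phi$ if it is $\mathfrak{T}_X$-nonsingular and for every holonomy $\psi\colon A\to B$ of $\mathfrak{T}_X$, $\frac{d(\mu\circ\psi)}{d\mu}(x)=\exp(\phi(x,\psi(x)))$ for $\mu$-a.e. $x\in A$, where $(\mu\circ\psi)(E)=\mu(\psi(E))$ for Borel $E\subseteq A$. Potentials: for continuous $f\colon X\to\mathbb{R}$ put $v_k(f)=\sup\{|f(x)-f(y)| : x_{[-k,k]}=y_{[-k,k]}\}$ for $k\ge 0$ and $v_{-1}(f)=\|f\|_\infty$. $\mathrm{SV}(X)$ is the set of continuous $f$ with $\sum_{k=0}^\infty v_{k-1}(f)<\infty$. For $f\in\mathrm{SV}(X)$ the absolutely convergent series $\phi_f(x,y)=\sum_{n\in\mathbb{Z}}[f(\sigma^n y)-f(\sigma^n x)]$ defines a cocycle on $\mathfrak{T}_X$; a Gibbs measure for $f$ means a Gibbs measure for $\phi_f$. (If $f\in\mathrm{SV}(Y)$ and $\pi\colon X\to Y$ is a factor code then $f\circ\pi\in\mathrm{SV}(X)$.) *)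

(* Defs.v *)
From HB Require Import structures.
From mathcomp Require Import all_boot all_order all_algebra.
From mathcomp Require Import all_classical all_reals all_analysis.

Set Implicit Arguments.
Unset Strict Implicit.
Unset Printing Implicit Defensive.

Import Order.TTheory GRing.Theory Num.Theory.
Import numFieldNormedType.Exports.

Local Open Scope classical_set_scope.
Local Open Scope ring_scope.

(* The library's measurable types are pointed, so alphabets are nonempty; this
   loses nothing, since there is no probability measure over an empty one. *)
#[short(type="alphabetType")]
HB.structure Definition Alphabet := {A of Finite A & Pointed A}.

Definition full_shift (A : alphabetType) : Type :=
  prod_topology (fun _ : int => discrete_topology A).

HB.instance Definition _ (A : alphabetType) := Pointed.on (full_shift A).
HB.instance Definition _ (A : alphabetType) := Nbhs.on (full_shift A).
HB.instance Definition _ (A : alphabetType) := Topological.on (full_shift A).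

HB.instance Definition _ (A : alphabetType) :=
  @isMeasurable.Build (sigma_display (@open (full_shift A))) (full_shift A)
    <<s @open (full_shift A) >> (@sigma_algebra0 _ setT _)
    (@sigma_algebraC _ _) (@sigma_algebra_bigcup _ setT _).

(* A shift space X, and everything living on it, is represented inside the full
   shift: points of X are points x with [X x], Borel subsets of X are Borel
   subsets of the full shift contained in X, maps and potentials on X are
   functions on the full shift whose values outside X are never used, and a
   measure on X is one on the full shift giving mass 1 to X. *)

Section ShiftSpaces.
Context {A : alphabetType}.
Implicit Types (X : set (full_shift A)) (x y : full_shift A) (w : seq A).

Definition shift_by (n : int) (x : full_shift A) : full_shift A :=
  fun m => x (m + n).

Definition shift_map : full_shift A -> full_shift A := shift_by 1.

Definition shift_space X : Prop := closed X /\ shift_map @` X = X.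

Definition occurs w x : Prop :=
  exists i : int, w = [seq x (i + j%:Z) | j <- iota 0 (size w)].

Definition language X : set (seq A) :=
  [set w | exists2 x, X x & occurs w x].

Definition irreducible_shift X : Prop :=
  forall u v, language X u -> language X v ->
    exists2 w, language X w & language X (u ++ w ++ v).

Definition shift_of_finite_type X : Prop :=
  shift_space X /\
  exists F : seq (seq A), X = [set x | forall w, w \in F -> ~ occurs w x].

Definition gibbs_rel X x y : Prop :=
  [/\ X x, X y & exists2 N : nat, (1 <= N)%N &
    forall n : int, N%:Z < `|n| -> x n = y n].

Definition saturation X (E : set (full_shift A)) : set (full_shift A) :=
  [set x' | exists2 x, E x & gibbs_rel X x x'].

Definition holonomy X (D E : set (full_shift A))
    (psi : full_shift A -> full_shift A) : Prop :=
  [/\ [/\ measurable D, measurable E, D `<=` X & E `<=` X],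
      set_bij D E psi,
      measurable_fun D psi,
      (forall F, measurable F -> F `<=` D -> measurable (psi @` F)) &
      forall x, D x -> gibbs_rel X x (psi x)].

End ShiftSpaces.

Section FactorCodes.
Context {A B : alphabetType}.

Definition factor_code (X : set (full_shift A)) (Y : set (full_shift B))
    (pi : full_shift A -> full_shift B) : Prop :=
  [/\ {within X, continuous pi},
      pi @` X = Y &
      forall x, X x -> pi (shift_map x) = shift_map (pi x)].

Definition finite_to_one (X : set (full_shift A)) (Y : set (full_shift B))
    (pi : full_shift A -> full_shift B) : Prop :=
  forall y, Y y -> finite_set (X `&` pi @^-1` [set y]).

End FactorCodes.

Definition sofic_shift {B : alphabetType} (Y : set (full_shift B)) : Prop :=
  shift_space Y /\
  exists (C : alphabetType) (Z : set (full_shift C))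
    (rho : full_shift C -> full_shift B),
    shift_of_finite_type Z /\ factor_code Z Y rho.

Section Potentials.
Context {R : realType} {A : alphabetType}.
Implicit Types (X : set (full_shift A)) (f : full_shift A -> R).

Definition sup_norm X f : \bar R := ereal_sup [set `|f x|%:E | x in X].

Definition window_variation X f (k : nat) : \bar R :=
  ereal_sup [set r | exists x y, [/\ X x, X y,
    (forall n : int, - k%:Z <= n <= k%:Z -> x n = y n) &
    r = `|f x - f y|%:E]].

(* v_{k-1}, with v_{-1} the supremum norm *)
Definition variation_pred X f (k : nat) : \bar R :=
  if k is k'.+1 then window_variation X f k' else sup_norm X f.

Definition summable_variation X f : Prop :=
  {within X, continuous f} /\
  (\sum_(0 <= k <oo) variation_pred X f k < +oo)%E.

(* The sum over n in Z is split into n >= 0 and n = -(k+1), k >= 0. *)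
Definition potential_cocycle f (x y : full_shift A) : R :=
  let d n := f (shift_by n y) - f (shift_by n x) in
  limn (series (fun k : nat => d k%:Z)) +
  limn (series (fun k : nat => d (- (k.+1)%:Z))).

End Potentials.

Section GibbsMeasures.
Context {R : realType} {A : alphabetType}.
Implicit Types (X : set (full_shift A)) (mu : probability (full_shift A) R).

Definition shift_invariant mu : Prop :=
  forall E, measurable E -> pushforward mu shift_map E = mu E.

(* The relation has countable classes and is generated by countably many
   holonomies, so saturations of Borel sets are Borel. *)
Definition gibbs_nonsingular X mu : Prop :=
  forall E, measurable E -> E `<=` X -> mu E = 0%E -> mu (saturation X E) = 0%E.

(* g is a version of the Radon-Nikodym derivative d(lambda)/d(mu) of a finite
   measure lambda defined on the Borel subsets of D only, whence not the
   library's ['d nu '/d mu], which is for charges on the whole space. *)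
Definition is_radon_nikodym mu (D : set (full_shift A))
    (lambda : set (full_shift A) -> \bar R) (g : full_shift A -> \bar R) : Prop :=
  mu.-integrable D g /\
  forall E, measurable E -> E `<=` D -> lambda E = (\int[mu]_(x in E) g x)%E.

Definition gibbs_measure X (phi : full_shift A -> full_shift A -> R) mu : Prop :=
  [/\ mu X = 1%E,
      gibbs_nonsingular X mu &
      forall D E psi, holonomy X D E psi ->
        exists2 g, is_radon_nikodym mu D (fun F => mu (psi @` F)) g &
          {ae mu, forall x, D x -> g x = (expR (phi x (psi x)))%:E}].

Definition gibbs_measure_for X (f : full_shift A -> R) mu : Prop :=
  gibbs_measure X (potential_cocycle f) mu.

End GibbsMeasures.

(* pi_* mu = nu for mu on X, pi being relevant on X only *)
Definition pushes_to {R : realType} {A B : alphabetType}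
    (X : set (full_shift A)) (pi : full_shift A -> full_shift B)
    (mu : probability (full_shift A) R) (nu : probability (full_shift B) R) :
    Prop :=
  forall E, measurable E -> mu (X `&` pi @^-1` E) = nu E.

(* Main.v *)
(* Let n(y) be the (finite) number of preimages of y in X. The lift of nu is
   mu(E) = \int n(y)^-1 #(E `&` pi^-1(y)) dnu(y); it is invariant and projects to
   nu. Since pi is a sliding block code, it maps Gibbs-equivalent points to
   Gibbs-equivalent points, so a holonomy of X restricts, on countably many pieces
   carried along the fibres, to a holonomy of Y that rewrites one finite word into
   another. The Gibbs property of nu for the latter gives that of mu, provided n is
   constant on almost every Gibbs class. This last fact needs neither degree theory
   nor ergodicity: n is shift-invariant, and a shift-invariant Borel set H agrees
   almost everywhere with a tail set (approximate H by cylinder sets with summable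
   errors, shift their windows off to infinity, and apply Borel-Cantelli), and
   nonsingularity then removes the exceptional null set together with its
   saturation. *)

Require Import Defs.
From HB Require Import structures.
From mathcomp Require Import all_boot all_order all_algebra.
From mathcomp Require Import all_classical all_reals all_analysis.
From mathcomp Require Import measurable_realfun zify.

Set Implicit Arguments.
Unset Strict Implicit.
Unset Printing Implicit Defensive.

Import Order.TTheory GRing.Theory Num.Theory.
Import numFieldNormedType.Exports.
Import HBNNSimple.

Local Open Scope classical_set_scope.
Local Open Scope ring_scope.

(** * Windows and cylinders in the full shift *)

Section Windows.
Context {A : alphabetType}.
Implicit Types (x y z : full_shift A) (X E U : set (full_shift A)) (w : seq A).

(* The window of size k consists of the k first integers in the enumeration of
   int given by pickle. *)
Definition agree (k : nat) x y : Prop :=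
  forall n : int, (pickle n < k)%N -> x n = y n.

(** The default of [nth] is the coordinate of [x] itself, so [x] is rewritten on the window of [w]
    and left alone elsewhere. *)
Definition overlay w x : full_shift A := fun n => nth (x n) w (pickle n).

(* Indices that are not of the form pickle n are filled with point. *)
Definition word (k : nat) x : seq A :=
  mkseq (fun i => odflt point (omap x (pickle_inv i))) k.

(** On the window of [w] the overlay does not depend on the point below it, so this is the usual
    cylinder; entries of [w] at indices that code no integer impose nothing. *)
Definition cylinder w : set (full_shift A) := [set x | agree (size w) x (overlay w x)].

Lemma agree_sym k x y : agree k x y -> agree k y x.
Proof. by move=> xy n nk; rewrite xy. Qed.

Lemma agree_trans k x y z : agree k x y -> agree k y z -> agree k x z.
Proof. by move=> xy yz n nk; rewrite xy// yz. Qed.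

Lemma agree_leq k l x y : (k <= l)%N -> agree l x y -> agree k x y.
Proof. by move=> kl xy n nk; rewrite xy// (leq_trans nk). Qed.

Lemma size_word k x : size (word k x) = k.
Proof. by rewrite size_mkseq. Qed.

Lemma nth_word k x n a : (pickle n < k)%N -> nth a (word k x) (pickle n) = x n.
Proof. by move=> nk; rewrite nth_mkseq// pickleK_inv. Qed.

Lemma agree_overlay w x y : agree (size w) (overlay w x) (overlay w y).
Proof. by move=> n nw; rewrite /overlay; apply: set_nth_default. Qed.

Lemma agree_wordP k x y : agree k x y <-> word k x = word k y.
Proof.
split=> [xy|xy n nk]; last by rewrite -(nth_word x point nk) xy nth_word.
apply: (@eq_from_nth _ point) => [|i]; rewrite !size_word// => ik.
rewrite !nth_mkseq//; case e : (pickle_inv i) => [n|]//=; apply: xy.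
by have := @pickle_invK int i; rewrite e /= => ->.
Qed.

Lemma overlay_out w x n : (size w <= pickle n)%N -> overlay w x n = x n.
Proof. by move=> wn; rewrite /overlay nth_default. Qed.

Lemma overlay_word k x y : agree k (overlay (word k x) y) x.
Proof. by move=> n nk; rewrite /overlay nth_word. Qed.

Lemma overlay_wordE k x y :
  (forall n, (k <= pickle n)%N -> x n = y n) -> overlay (word k y) x = y.
Proof.
move=> xy; apply/funext => n; have [nk|kn] := ltnP (pickle n) k.
  by rewrite overlay_word.
by rewrite overlay_out ?size_word// xy.
Qed.

Lemma cylinder_word k x : cylinder (word k x) x.
Proof. by rewrite /cylinder/= size_word; apply/agree_sym/overlay_word. Qed.

Lemma cylinder_agree w x y : cylinder w x -> cylinder w y -> agree (size w) x y.
Proof.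
rewrite /cylinder/= => wx wy; apply: (agree_trans wx); apply: (agree_trans _ (agree_sym wy)).
exact: agree_overlay.
Qed.

Lemma agree_cylinder w x y : agree (size w) x y -> cylinder w x -> cylinder w y.
Proof.
rewrite /cylinder/= => xy wx; apply: (agree_trans (agree_sym xy)).
exact: (agree_trans wx (@agree_overlay w x y)).
Qed.

Lemma cylinder_overlay w x : cylinder w x -> overlay w x = x.
Proof.
move=> wx; apply/funext => n; have [nw|wn] := ltnP (pickle n) (size w).
  by rewrite -wx.
by rewrite overlay_out.
Qed.

Lemma overlay_overlay u w x : (size w <= size u)%N ->
  overlay u (overlay w x) = overlay u x.
Proof.
move=> wu; apply/funext => n; have [nu|un] := ltnP (pickle n) (size u).
  exact: agree_overlay.
by rewrite !overlay_out// (leq_trans wu).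
Qed.

Lemma overlay_cylinder w x : overlay w x = x -> cylinder w x.
Proof. by move=> wx n nw; rewrite wx. Qed.

Lemma cylinder_overlaid w x : cylinder w (overlay w x).
Proof. by apply: overlay_cylinder; exact: overlay_overlay. Qed.

Lemma agree_all x y : (forall k, agree k x y) -> x = y.
Proof. by move=> xy; apply/funext => n; apply: (xy (pickle n).+1). Qed.

Lemma open_proj (n : int) (a : A) : open [set x : full_shift A | x n = a].
Proof.
rewrite (_ : mkset _ =
  (proj n : full_shift A -> discrete_topology A) @^-1` [set a])//.
apply: open_comp; last exact: discrete_open.
by move=> x _; exact: proj_continuous.
Qed.

Lemma nbhs_agree k x : nbhs x (agree k x).
Proof.
elim: k => [|k ih].
  by apply: filterS filterT.
case e : (@pickle_inv int k) => [n|].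
  have : nbhs x [set y : full_shift A | y n = x n].
    by apply: open_nbhs_nbhs; split => //; exact: open_proj.
  apply: filterS2 ih => y xy yn m; rewrite ltnS leq_eqVlt => /predU1P[mk|]; last exact: xy.
  by move: e; rewrite -mk pickleK_inv => -[->].
apply: filterS ih => y xy m; rewrite ltnS leq_eqVlt => /predU1P[mk|]; last exact: xy.
by move: e; rewrite -mk pickleK_inv.
Qed.

Lemma full_shift_compact : compact [set: full_shift A].
Proof.
rewrite (_ : [set: _] = [set x : full_shift A | forall i : int, [set: discrete_topology A] (x i)]).
  apply: (@tychonoff int (fun=> discrete_topology A) (fun=> setT)) => i.
  apply: finite_compact; exact: finite_finset.
by apply/seteqP; split.
Qed.

Lemma full_shift_hausdorff : hausdorff_space (full_shift A).
Proof.
apply: (@hausdorff_product int (fun=> discrete_topology A)) => i.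
exact: discrete_hausdorff.
Qed.

(** Each point outside an open neighbourhood of [x] is separated from [x] by some window. The
    complement is compact, so a single window separates all of them. *)
Lemma nbhs_agreeP x U : nbhs x U <-> exists k, agree k x `<=` U.
Proof.
split=> [|[k]]; last by move=> kU; apply: filterS kU _; exact: nbhs_agree.
rewrite nbhsE => -[V [oV Vx] VU].
have /compact_near_coveringP cV : compact (~` V).
  apply: subclosed_compact full_shift_compact _ => //; exact: open_closedC.
have : \forall k \near \oo, ~` V `<=` [set z | ~ agree k x z].
  apply: (cV nat \oo (fun k z => ~ agree k x z)) => z Vz.
  have [k xz] : exists k, ~ agree k x z.
    by apply: contrapT => /forallNP xz; apply: Vz; rewrite -(agree_all (fun k => contrapT (xz k))).
  exists (agree k z, [set l | (k <= l)%N]).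
    by split; [exact: nbhs_agree|exact: nbhs_infty_ge].
  move=> [z' l] [/= zz' kl] xz'; apply: xz; apply: (agree_trans (agree_leq kl xz')).
  exact: agree_sym.
move=> [k _ /(_ _ (leqnn k)) kV]; exists k => z xz; apply: VU.
by apply: contrapT => /kV; exact.
Qed.

Lemma open_agreeP U : open U <-> forall x, U x -> exists k, agree k x `<=` U.
Proof.
rewrite openE; split => oU x Ux; first by apply/nbhs_agreeP/oU.
by apply/nbhs_agreeP/oU.
Qed.

Lemma closed_agreeP E : closed E <->
  forall x, (forall k, exists2 y, E y & agree k x y) -> E x.
Proof.
rewrite -openC open_agreeP; split => cE x.
  move=> xE; apply: contrapT => /cE[k kE]; have [y Ey xy] := xE k.
  exact: kE Ey.
move=> nEx; apply: contrapT => /forallNP xE; apply/nEx/cE => k.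
have /existsNP[y /not_implyP[xy /contrapT Ey]] := xE k.
by exists y.
Qed.

Lemma open_measurable_shift (U : set (full_shift A)) : open U -> measurable U.
Proof. by move=> oU; exact: sub_sigma_algebra. Qed.

Lemma closed_measurable_shift E : closed E -> measurable E.
Proof.
move=> cE; rewrite -(setCK E); apply: measurableC.
by apply: open_measurable_shift; exact: closed_openC.
Qed.

Lemma open_cylinder w : open (cylinder w).
Proof.
by apply/open_agreeP => x wx; exists (size w) => y xy; exact: agree_cylinder wx.
Qed.

Lemma measurable_cylinder w : measurable (cylinder w).
Proof. by apply: open_measurable_shift; exact: open_cylinder. Qed.

End Windows.

Arguments agree_overlay {A} w x y.
Arguments overlay_word {A} k x y.
Arguments cylinder_word {A} k x.

(** * Borel maps, the shift action and the Gibbs relation in terms of words *)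

Section Measurability.
Context {A : alphabetType}.
Implicit Types (x y z : full_shift A) (X E U : set (full_shift A)) (w : seq A).

Lemma measurable_coord (n : int) (a : A) : measurable [set x : full_shift A | x n = a].
Proof. by apply: open_measurable_shift; exact: open_proj. Qed.

(** Closed sets are stable under intersection, and by compactness their images under a code are
    closed. This makes them the starting point of the later Dynkin inductions. *)
Lemma measurable_closedE : @measurable _ (full_shift A) = <<s @closed (full_shift A) >>.
Proof.
apply/seteqP; split; apply: smallest_sub; first exact: smallest_sigma_algebra.
- move=> U oU; rewrite -(setCK U); apply: sigma_algebraC.
  by apply: sub_sigma_algebra; exact: open_closedC.
- exact: sigma_algebra_measurable.
- by move=> F; exact: closed_measurable_shift.
Qed.

(** An open set is a union of cylinders, of which there are only countably many, and a cylinder is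
    cut out by conditions on single coordinates. *)
Lemma measurable_fun_coordP d (T : measurableType d) (D : set T)
    (f : T -> full_shift A) : measurable D ->
  (forall (n : int) (a : A), measurable (D `&` [set t | f t n = a])) ->
  measurable_fun D f.
Proof.
move=> mD mf; apply: (measurability (@open (full_shift A))) => //.
move=> _ [U oU <-].
have -> : D `&` f @^-1` U =
    \bigcup_(w in [set w | cylinder w `<=` U]) (D `&` f @^-1` cylinder w).
  apply/seteqP; split=> [t [Dt Uft]|t [w wU [Dt /wU]//]].
  have /open_agreeP/(_ _ Uft)[k kU] := oU.
  exists (word k (f t)); last by split => //; exact: cylinder_word.
  move=> y /(cylinder_agree (cylinder_word k (f t))).
  by rewrite size_word => /kU.
rewrite bigcup_mkcond; apply: countable_bigcupT_measurable; first exact: countableP.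
move=> w.
case: ifPn => // _.
(* Indices [k] that code no integer or lie past the word impose no condition beyond membership in
   [D]. *)
have -> : D `&` f @^-1` cylinder w = \bigcap_(k : nat)
    (if @pickle_inv int k is Some n then
      if (k < size w)%N then D `&` [set t | f t n = nth point w k] else D
     else D).
  apply/seteqP; split => [t [Dt wt] k _|t wt].
    case e : (pickle_inv k) => [n|]//; case: ifPn => // kw; split=> //=.
    have nk : pickle n = k by have := @pickle_invK int k; rewrite e.
    rewrite wt ?nk// /overlay nk; exact: set_nth_default.
  have Dt : D t by have := wt 0 I; case: pickle_inv => // n; case: ifP => // _ [].
  split => // n nw; have := wt (pickle n) I; rewrite pickleK_inv nw => -[_ /= ->].
  exact: set_nth_default.
apply: bigcapT_measurable => k; case: pickle_inv => // n.
by case: ifPn => // _; exact: mf.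
Qed.

(** Two points are equal when their words of every length are equal, and there are countably many
    words. *)
Lemma measurable_eq_fun_shift d (T : measurableType d) (D : set T)
    (f g : T -> full_shift A) : measurable D ->
  measurable_fun D f -> measurable_fun D g -> measurable (D `&` [set t | f t = g t]).
Proof.
move=> mD mf mg.
rewrite (_ : _ `&` _ = \bigcap_k (\bigcup_(w : seq A)
    ((D `&` f @^-1` [set x | word k x = w]) `&` (D `&` g @^-1` [set x | word k x = w])))).
  apply: bigcapT_measurable => k; apply: countable_bigcupT_measurable => [|w].
    exact: countableP.
  have mw : measurable [set x : full_shift A | word k x = w].
    apply: open_measurable_shift; apply/open_agreeP => x <-; exists k => y xy.
    by apply/esym/agree_wordP.
  by apply: measurableI; [exact: mf|exact: mg].
apply/seteqP; split => [t [Dt fg] k _|t fgt].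
  by exists (word k (f t)) => //; split; split => //=; rewrite fg.
have [_ _ [[Dt _] _]] := fgt 0%N I; split => //=; apply: agree_all => k.
by have [w _ [[_ /= fw] [_ /= gw]]] := fgt k I; apply/agree_wordP; rewrite fw gw.
Qed.

Lemma measurable_shift_by n : measurable_fun setT (@shift_by A n).
Proof.
apply: measurable_fun_coordP => // m a; rewrite setTI.
exact: measurable_coord.
Qed.

Lemma measurable_overlay w : measurable_fun setT (overlay w).
Proof.
apply: measurable_fun_coordP => // n a; rewrite setTI /overlay.
have [nw|wn] := ltnP (pickle n) (size w).
  rewrite (_ : mkset _ = [set x : full_shift A | nth point w (pickle n) = a]); last first.
    by apply/seteqP; split => x /=; rewrite (set_nth_default (x n) point nw).
  have [->|na] := pselect (nth point w (pickle n) = a).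
    by rewrite (_ : mkset _ = setT)//; apply/seteqP; split.
  by rewrite (_ : mkset _ = set0)//; apply/seteqP; split.
rewrite (_ : mkset _ = [set x | x n = a]); first exact: measurable_coord.
by apply/seteqP; split => x /=; rewrite nth_default.
Qed.

Lemma measurable_overlay_preimage w E : measurable E -> measurable (overlay w @^-1` E).
Proof. by move=> mE; rewrite -[X in measurable X]setTI; exact: measurable_overlay. Qed.

Lemma shift_by_add m n x : shift_by m (shift_by n x) = shift_by (m + n) x.
Proof. by apply/funext => i; rewrite /shift_by -addrA. Qed.

Lemma shift_by0 x : shift_by 0 x = x.
Proof. by apply/funext => i; rewrite /shift_by addr0. Qed.

Lemma shift_by_space X n x : shift_space X -> X x -> X (shift_by n x).
Proof.
move=> [_ sX].
have up y : X y -> X (shift_map y) by move=> Xy; rewrite -sX; exists y.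
have dn y : X y -> X (shift_by (-1) y).
  by rewrite -{1}sX => -[z Xz <-]; rewrite /shift_map shift_by_add addNr shift_by0.
elim/int_ind : n => [|n ih|n ih] Xx; first by rewrite shift_by0.
  by rewrite intS -shift_by_add; apply: up; exact: ih.
by rewrite intS opprD -shift_by_add; apply: dn; exact: ih.
Qed.

Lemma shift_space_shift_map X x : shift_space X -> X (shift_map x) <-> X x.
Proof.
move=> sX; split=> [|Xx]; last exact: shift_by_space.
by move=> /(shift_by_space (-1) sX); rewrite /shift_map shift_by_add addNr shift_by0.
Qed.

Lemma gibbs_relP X x y : gibbs_rel X x y <->
  [/\ X x, X y & exists k, forall n : int, (k <= pickle n)%N -> x n = y n].
Proof.
split=> [[Xx Xy [N _ xy]]|[Xx Xy [k xy]]]; split => //.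
  (* The integers [i - N] with [i < 2N + 1] exhaust the interval from [-N] to [N]; a code above all
     of theirs belongs to an [n] with [|n| > N]. *)
  exists (\max_(i < N.*2.+1) pickle (i%:Z - N%:Z)%R).+1 => n kn.
  apply: xy; rewrite ltNge; apply/negP => nN.
  have lti : (`|(n + N%:Z)%R| < N.*2.+1)%N by lia.
  have := @leq_bigmax _ (fun i : 'I_(N.*2.+1) => pickle (i%:Z - N%:Z)%R) (Ordinal lti).
  rewrite leqNgt => /negP; apply.
  by rewrite /= (_ : (`|(n + N%:Z)%R|%N)%:Z - N%:Z = n)//; lia.
(* Conversely, the largest absolute value in the window of size [k] serves as [N]; the successor
   makes it at least 1. *)
exists (\max_(i < k) odflt 0%N (omap (fun n : int => `|n|%N) (unpickle i))).+1 => // n Nn.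
apply: xy; rewrite leqNgt; apply/negP => nk.
have := @leq_bigmax _ (fun i : 'I_k => odflt 0%N (omap (fun n : int => `|n|%N) (unpickle i)))
  (Ordinal nk).
move: Nn; set m := (\max_(i < k) _)%N.
by rewrite /= pickleK/=; move: m => m; lia.
Qed.

Lemma gibbs_rel_sym X x y : gibbs_rel X x y -> gibbs_rel X y x.
Proof. by move=> [Xx Xy [N N1 xy]]; split => //; exists N => // n /xy. Qed.

Lemma gibbs_rel_overlay X w x : X x -> X (overlay w x) -> gibbs_rel X x (overlay w x).
Proof.
move=> Xx Xwx; apply/gibbs_relP; split => //; exists (size w) => n nw.
by rewrite overlay_out.
Qed.

(** The countably many maps [overlay w] reach every Gibbs-equivalent point. This replaces the
    countable group that generates the relation. *)
Lemma gibbs_rel_overlayP X x y : gibbs_rel X x y ->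
  exists k, forall l, (k <= l)%N -> overlay (word l y) x = y.
Proof.
move=> /gibbs_relP[_ _ [k xy]]; exists k => l kl; apply: overlay_wordE => n ln.
by apply: xy; exact: leq_trans ln.
Qed.

Lemma saturationE X E : E `<=` X ->
  saturation X E = X `&` \bigcup_w (overlay w @^-1` E).
Proof.
move=> EX; apply/seteqP; split => [y [x Ex xy]|y [Xy [w _ Ewy]]].
  split; first by case: xy.
  have [k /(_ _ (leqnn k)) kx] := gibbs_rel_overlayP (gibbs_rel_sym xy).
  by exists (word k x) => //=; rewrite kx.
exists (overlay w y) => //; apply: gibbs_rel_sym; apply: gibbs_rel_overlay => //.
exact: EX.
Qed.

Lemma measurable_saturation X E : measurable X -> measurable E -> E `<=` X ->
  measurable (saturation X E).
Proof.
move=> mX mE EX; rewrite saturationE//; apply: measurableI => //.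
apply: countable_bigcupT_measurable; first exact: countableP.
move=> w; exact: measurable_overlay_preimage.
Qed.

End Measurability.

(** * Sliding block codes *)

Section SlidingBlockCodes.
Context {A B : alphabetType}.
Variables (X : set (full_shift A)) (pi : full_shift A -> full_shift B).

Lemma within_continuous_agree x k : {within X, continuous pi} -> X x ->
  exists l, forall z, X z -> agree l x z -> agree k (pi x) (pi z).
Proof.
move=> /subspace_continuousP cpi Xx.
have /nbhs_agreeP[l lx] := cpi x Xx _ (nbhs_agree k (pi x)).
by exists l => z Xz /lx; exact.
Qed.

Lemma within_continuous_measurable : closed X -> {within X, continuous pi} ->
  measurable_fun X pi.
Proof.
move=> cX cpi; apply: measurable_fun_coordP => [|n b]; first exact: closed_measurable_shift.
rewrite (_ : _ `&` _ = X `&` \bigcup_(w in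
  [set w | forall z, X z -> cylinder w z -> pi z n = b]) cylinder w).
  apply: measurableI; first exact: closed_measurable_shift.
  rewrite bigcup_mkcond; apply: countable_bigcupT_measurable => [|w].
    exact: countableP.
  by case: ifP => // _; exact: measurable_cylinder.
apply/seteqP; split => [x [Xx /= xb]|x [Xx [w /= wb wx]]]; split => //=.
  have [l lx] := within_continuous_agree (pickle n).+1 cpi Xx.
  exists (word l x); last exact: cylinder_word.
  move=> z Xz lz; rewrite -xb; apply/esym/lx => //.
  by have := cylinder_agree (cylinder_word l x) lz; rewrite size_word.
exact: wb.
Qed.

Lemma within_continuous_closed_image E : closed X -> closed E ->
  {within X, continuous pi} -> closed (pi @` (X `&` E)).
Proof.
move=> cX cE cpi; apply: compact_closed; first exact: full_shift_hausdorff.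
apply: continuous_compact.
  by apply: continuous_subspaceW cpi => x [].
by apply: subclosed_compact full_shift_compact _ => //; exact: closedI.
Qed.

(** The sliding block form of a continuous map: continuity gives a window at each point of [X], and
    compactness a common one. *)
Lemma uniform_window : closed X -> {within X, continuous pi} ->
  exists k, forall x z, X x -> X z -> agree k x z -> pi x 0 = pi z 0.
Proof.
move=> cX cpi.
have /compact_near_coveringP covX : compact X.
  by apply: subclosed_compact full_shift_compact _.
have : \forall k \near \oo, X `<=` [set x | forall z, X x -> X z -> agree k x z -> pi x 0 = pi z 0].
  apply: (covX nat \oo (fun k x => forall z, X x -> X z -> agree k x z -> pi x 0 = pi z 0)).
  move=> x Xx; have [l lx] := within_continuous_agree (@pickle int 0).+1 cpi Xx.
  exists (agree l x, [set k | (l <= k)%N]).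
    by split; [exact: nbhs_agree|exact: nbhs_infty_ge].
  move=> [x' k] [/= xx' lk] z Xx' Xz x'z.
  rewrite -(lx _ Xx' xx')// -(lx _ Xz)//.
  by apply: (agree_trans xx'); exact: agree_leq x'z.
by move=> [k _ /(_ _ (leqnn k)) kX]; exists k => x z Xx Xz; exact: kX.
Qed.

Hypothesis shiftX : shift_space X.
Hypothesis pi_shift : forall x, X x -> pi (shift_map x) = shift_map (pi x).

Lemma code_shift_by n x : X x -> pi (shift_by n x) = shift_by n (pi x).
Proof.
have dn y : X y -> pi (shift_by (-1) y) = shift_by (-1) (pi y).
  move=> Xy; have := pi_shift (shift_by_space (-1) shiftX Xy).
  rewrite /shift_map shift_by_add subrr shift_by0 => ->.
  by rewrite shift_by_add addNr shift_by0.
elim/int_ind : n x => [|n ih|n ih] x Xx; first by rewrite !shift_by0.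
  rewrite intS -!shift_by_add -/shift_map pi_shift ?ih//.
  exact: shift_by_space.
rewrite intS opprD -!shift_by_add dn ?ih//; exact: shift_by_space.
Qed.

(** Coordinate [n] of the image depends only on a fixed window translated by [n]. For [n] far enough
    from 0 this translate misses the coordinates where [x] and [z] differ. *)
Lemma code_gibbs_rel (Y : set (full_shift B)) x z :
  {within X, continuous pi} -> pi @` X `<=` Y ->
  gibbs_rel X x z -> gibbs_rel Y (pi x) (pi z).
Proof.
move=> cpi piXY [Xx Xz [N N1 xz]].
have [k kP] := uniform_window shiftX.1 cpi.
pose M := \max_(i < k) odflt 0%N (omap (fun n : int => `|n|%N) (unpickle i)).
split; [by apply: piXY; exists x|by apply: piXY; exists z|].
exists (N + M)%N => [|n Nn]; first by rewrite addn_gt0 N1.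
have -> : pi x n = shift_by n (pi x) 0 by rewrite /shift_by add0r.
have -> : pi z n = shift_by n (pi z) 0 by rewrite /shift_by add0r.
rewrite -!code_shift_by//; apply: kP; [exact: shift_by_space..|].
move=> i ik; rewrite /shift_by; apply: xz.
have : (`|i| <= M)%N.
  have := @leq_bigmax _ (fun i : 'I_k =>
    odflt 0%N (omap (fun n : int => `|n|%N) (unpickle i))) (Ordinal ik).
  by rewrite /= pickleK.
by move: Nn; move: (M); lia.
Qed.

(** The two pairs of series agree term by term, so no convergence is involved. *)
Lemma potential_cocycle_code (R : realType) (f : full_shift B -> R) x z :
  X x -> X z -> potential_cocycle (f \o pi) x z = potential_cocycle f (pi x) (pi z).
Proof.
move=> Xx Xz; rewrite /potential_cocycle; congr (limn (series _) + limn (series _));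
  by apply/funext => k /=; rewrite !code_shift_by.
Qed.

End SlidingBlockCodes.

(** * Counting points in fibres *)

Section Counting.
Context {R : realType}.

Lemma counting_card (T : choiceType) (S : set T) n :
  (S #= `I_n)%card -> counting S = n%:R%:E :> \bar R.
Proof.
move=> Sn; rewrite /counting asboolT ?(card_fset_set Sn)//.
by exists n.
Qed.

Lemma counting_image (T U : choiceType) (f : T -> U) (S : set T) :
  finite_set S -> {in S &, injective f} -> counting (f @` S) = counting S :> \bar R.
Proof.
move=> [n Sn] injf; rewrite (counting_card Sn); apply: counting_card.
by apply: card_eq_trans Sn; exact: inj_card_eq.
Qed.

Lemma counting_fin_num (T : choiceType) (S : set T) :
  finite_set S -> (counting S : \bar R) \is a fin_num.
Proof. by move=> [n Sn]; rewrite (counting_card Sn). Qed.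

Lemma counting_eq0 (T : choiceType) (S : set T) :
  (counting S = 0 :> \bar R)%E <-> S = set0.
Proof.
split=> [|->]; last by rewrite /counting asboolT ?fset_set0.
rewrite /counting; case: asboolP => // finS => -[/eqP].
by rewrite pnatr_eq0 finmap.cardfs_eq0 => /eqP; exact: fset_set_set0.
Qed.

Lemma counting_ge0 (T : choiceType) (S : set T) : (0 <= counting S :> \bar R)%E.
Proof. by rewrite /counting; case: ifPn; rewrite ?lee_fin ?lee_pinfty. Qed.

Lemma counting_sum_indic (T : finType) (S : set T) :
  counting S = (\sum_t \1_S t)%:E :> \bar R.
Proof.
rewrite /counting asboolT; last exact: finite_finset.
rewrite (eq_bigr (fun t => (t \in S)%:R))//.
rewrite -natr_sum -big_mkcond/= sum1_card cardE; congr (_%:R%:E).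
apply: perm_size; apply: uniq_perm; [exact: finmap.fset_uniq|exact: enum_uniq|].
move=> t; rewrite mem_enum/=; apply: in_fset_set; exact: finite_finset.
Qed.

End Counting.

Section FiniteSets.
Context {A : alphabetType}.

Lemma finite_measurable_shift (S : set (full_shift A)) : finite_set S -> measurable S.
Proof.
move=> fS; rewrite (_ : S = \bigcup_(x in S) [set x]).
  apply: fin_bigcup_measurable => // x _; apply: closed_measurable_shift.
  by apply/closed_agreeP => z zx; apply: agree_all => k; have [_ -> ] := zx k.
by apply/seteqP; split=> [x Sx|x [y Sy ->//]]; exists x.
Qed.

(** Each of the finitely many pairs of distinct points is separated by some window; the largest of
    these windows separates all pairs. *)
Lemma finite_window (S : set (full_shift A)) : finite_set S ->
  exists k, forall l, (k <= l)%N -> {in S &, injective (word l)}.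
Proof.
move=> /finite_seqP[s ->].
have /choice[sep sepP] : forall p : full_shift A * full_shift A,
    exists k, agree k p.1 p.2 -> p.1 = p.2.
  move=> [x z]/=; have [xz|/forallNP xz] := pselect (exists k, ~ agree k x z).
    by have [k xzk] := xz; exists k.
  by exists 0%N => _; apply: agree_all => k; exact: contrapT.
exists (\max_(p <- [seq (x, z) | x <- s, z <- s]) sep p)%N => l kl x z.
move=> /set_mem/= xs /set_mem/= zs xz; apply: (sepP (x, z)) => /=.
apply: (@agree_leq _ _ l).
  apply: leq_trans kl; apply: leq_bigmax_seq => //.
  by apply/allpairsP; exists (x, z).
exact/agree_wordP.
Qed.

End FiniteSets.

(** * Measurability of the number of preimages *)

Section FibreCount.
Context {R : realType} {A B : alphabetType}.
Variables (X : set (full_shift A)) (pi : full_shift A -> full_shift B).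

Definition fibre_count (E : set (full_shift A)) (y : full_shift B) : \bar R :=
  counting (X `&` pi @^-1` [set y] `&` E).

Hypothesis finite_fibre : forall y, finite_set (X `&` pi @^-1` [set y]).

Let finite_fibreI y E : finite_set (X `&` pi @^-1` [set y] `&` E).
Proof. by apply: sub_finite_set (finite_fibre y) => x []. Qed.

Lemma fibre_count_fin_num E y : fibre_count E y \is a fin_num.
Proof. exact: counting_fin_num. Qed.

Lemma fibre_count_bigcup (F : (set (full_shift A))^nat) y :
  (forall n, measurable (F n)) -> trivIset setT F ->
  fibre_count (\bigcup_n F n) y = (\sum_(0 <= n <oo) fibre_count (F n) y)%E.
Proof.
move=> mF tF; rewrite /fibre_count setI_bigcupr measure_bigcup//=.
  by apply: eq_eseriesl => n; rewrite in_setT.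
- by move=> n _; exact: finite_measurable_shift.
- exact: trivIset_setIl.
Qed.

Lemma fibre_count_setC E y : measurable E ->
  fibre_count (~` E) y = (fibre_count setT y - fibre_count E y)%E.
Proof.
move=> mE; set S := X `&` pi @^-1` [set y].
have mS U : measurable (S `&` U).
  by apply: finite_measurable_shift; exact: finite_fibreI.
have -> : fibre_count setT y = (fibre_count (~` E) y + fibre_count E y)%E.
  rewrite /fibre_count -/S -measureU//=; last first.
    by apply/seteqP; split => // x /= [[_ nEx] [_ /nEx]].
  by rewrite -setIUr setvU.
by rewrite addeK// fibre_count_fin_num.
Qed.

(** Once words of length [l] tell the points of the fibre apart, counting points amounts to counting
    the words that occur. The count is thus an eventually constant limit of sums of indicators of
    projected sets. *)
Lemma fibre_count_indic E y : exists k, forall l, (k <= l)%N ->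
  fibre_count E y =
  (\sum_(w : l.-tuple A) \1_(pi @` (X `&` (E `&` [set x | word l x = w]))) y)%:E.
Proof.
have [k kP] := finite_window (finite_fibreI y E).
exists k => l kl; pose tw x : l.-tuple A := Tuple (introT eqP (size_word l x)).
rewrite /fibre_count -(@counting_image R _ _ tw)//; last first.
  by move=> x z xS zS [] /(kP l kl); exact.
rewrite counting_sum_indic; congr (_%:E); apply: eq_bigr => w _.
rewrite !indicE; congr ((nat_of_bool _)%:R); apply/idP/idP => /set_mem.
  by move=> [x [[Xx xy] Ex] <-]; apply/mem_set; exists x.
move=> [x [Xx [Ex xw]] xy]; apply/mem_set; exists x => //.
exact: val_inj.
Qed.

(** For closed [E] the projected sets are closed by compactness, and the count is a pointwise limit
    of measurable functions. Complements and disjoint unions follow because fibres are finite and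
    counting is additive; Dynkin induction concludes. *)
Lemma measurable_fun_fibre_count E : closed X -> {within X, continuous pi} ->
  measurable E -> measurable_fun setT (fibre_count E).
Proof.
move=> cX cpi; have cM F : closed F -> measurable_fun setT (fibre_count F).
  move=> cF; apply: (emeasurable_fun_cvg (fun l y =>
    (\sum_(w : l.-tuple A) \1_(pi @` (X `&` (F `&` [set x | word l x = w]))) y)%:E)).
    move=> l; apply/measurable_EFinP; apply: measurable_sum => w.
    apply: measurable_indic; apply: closed_measurable_shift.
    apply: within_continuous_closed_image => //; apply: closedI => //.
    apply/closed_agreeP => x /(_ l)[z <- xz]; exact/agree_wordP.
  move=> y _; have [k kP] := fibre_count_indic F y.
  by apply: cvg_near_cst; exists k => // l /= kl; rewrite (kP l kl).
rewrite measurable_closedE => mE.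
apply: (dynkin_induction (P := fun E => measurable_fun setT (fibre_count E))
  measurable_closedE _ _ _ _ _ mE).
- exact: closedI.
- by apply: cM; exact: closedT.
- exact: cM.
- move=> F mF cF; rewrite (_ : fibre_count _ = fun y => (fibre_count setT y - fibre_count F y)%E).
    by apply: emeasurable_funB => //; apply: cM; exact: closedT.
  by apply/funext => y; exact: fibre_count_setC.
- move=> F mF tF cF; rewrite (_ : fibre_count _ =
      fun y => (\sum_(0 <= n <oo) fibre_count (F n) y)%E).
    by apply: ge0_emeasurable_sum => // n y _ _; exact: counting_ge0.
  by apply/funext => y; exact: fibre_count_bigcup.
Qed.

End FibreCount.

(** * Densities and pushforwards *)

Section Density.
Context {R : realType} d1 d2 {T1 : measurableType d1} {T2 : measurableType d2}.
Local Open Scope ereal_scope.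

(** Change of variables when the image under [p] of [m] restricted to [F] has density [q] with
    respect to [n]: checked on simple functions, then passed to the limit by monotone
    convergence. *)
Lemma integral_density (m : {measure set T1 -> \bar R}) (n : {measure set T2 -> \bar R})
    (F : set T1) (p : T1 -> T2) (q : T2 -> R) :
  measurable F -> measurable_fun setT p -> measurable_fun setT q ->
  (forall y, 0 <= q y)%R ->
  (forall S, measurable S -> m (F `&` p @^-1` S) = \int[n]_(y in S) (q y)%:E) ->
  forall h : T2 -> \bar R, measurable_fun setT h -> (forall y, 0 <= h y) ->
  \int[m]_(x in F) h (p x) = \int[n]_y (h y * (q y)%:E).
Proof.
move=> mF mp mq q0 mnq h mh h0; pose f_ := nnsfun_approx measurableT mh.
have cvgf y : (f_ k y)%:E @[k --> \oo] --> h y by exact: cvg_nnsfun_approx.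
have mpF S : measurable S -> measurable (p @^-1` S).
  by move=> mS; rewrite -[X in measurable X]setTI; exact: mp.
transitivity (limn (fun k => \int[m]_(x in F) (f_ k (p x))%:E)).
  rewrite -monotone_convergence//.
  - by apply: eq_integral => x _; apply/esym/cvg_lim => //; exact: cvgf.
  - move=> k; apply/measurable_EFinP; apply: measurable_funTS.
    exact: measurableT_comp.
  - by move=> k x _; rewrite lee_fin.
  - by move=> x _ i j ij; rewrite lee_fin; exact/lefP/nd_nnsfun_approx.
transitivity (limn (fun k => \int[n]_y ((f_ k y)%:E * (q y)%:E))); last first.
  rewrite -monotone_convergence//.
  - apply: eq_integral => y _; apply/cvg_lim => //.
    by apply: cvgeZr => //; exact: cvgf.
  - by move=> k; apply: emeasurable_funM; exact/measurable_EFinP.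
  - by move=> k y _; rewrite mule_ge0// lee_fin.
  - move=> y _ i j ij; rewrite lee_wpmul2r// lee_fin//.
    exact/lefP/nd_nnsfun_approx.
congr (limn _); apply/funext => k.
have mS r : measurable (f_ k @^-1` [set r]) by [].
have mindic r : measurable_fun setT (fun x => \1_(f_ k @^-1` [set r]) (p x) : R).
  rewrite (_ : (fun x => _) = \1_(p @^-1` (f_ k @^-1` [set r])))//.
  by apply: measurable_indic; exact: mpF.
(* For a simple function both integrals equal this finite sum over its values; the density
   hypothesis is applied to each level set. *)
transitivity (\sum_(r \in range (f_ k)) r%:E * m (F `&` p @^-1` (f_ k @^-1` [set r]))).
  under eq_integral do rewrite fimfunE -fsumEFin//.
  rewrite ge0_integral_fsum//; last 2 first.
  - move=> r; apply/measurable_EFinP/measurable_funTS; exact: measurable_funM.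
  - by move=> r x _; rewrite nnfun_muleindic_ge0.
  apply: eq_fsbigr => r; rewrite inE => -[y _ <-].
  under eq_integral do rewrite EFinM.
  rewrite ge0_integralZl_EFin//.
  - congr (_ * _); rewrite setIC -integral_indic//; last exact: mpF.
  - exact/measurable_EFinP/measurable_funTS.
under [RHS]eq_integral.
  move=> y _; rewrite [f_ k y]fimfunE -fsumEFin// ge0_mule_fsuml; last first.
    by move=> r; rewrite nnfun_muleindic_ge0.
  over.
rewrite ge0_integral_fsum//; last 2 first.
- move=> r; apply: emeasurable_funM; apply/measurable_EFinP => //.
  by apply: measurable_funM => //; exact: measurable_indic.
- by move=> r y _; rewrite mule_ge0 ?lee_fin// -lee_fin nnfun_muleindic_ge0.
apply: eq_fsbigr => r; rewrite inE => -[y _ <-].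
rewrite mnq// integral_mkcond -ge0_integralZl_EFin//.
- apply: eq_integral => z _; rewrite EFinM -muleA; congr (_ * _).
  by rewrite patchE indicE; case: ifP; rewrite ?mul1e ?mul0e.
- by move=> z _; rewrite patchE; case: ifP => // _; rewrite lee_fin.
- apply/(measurable_restrictT _ _).1 => //; apply: measurable_funTS.
  exact/measurable_EFinP.
Qed.

End Density.

Section Probability.
Context {R : realType} d {T : measurableType d}.
Local Open Scope ereal_scope.

Lemma probability_exists (m : set T -> \bar R) :
  m set0 = 0 -> (forall E, 0 <= m E) -> semi_sigma_additive m -> m setT = 1 ->
  exists mu : probability T R, forall E, mu E = m E.
Proof.
move=> m0 mge0 msa m1.
pose M := isMeasure.Build _ _ _ m m0 mge0 msa.
pose mm : {measure set T -> \bar R} := HB.pack m M.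
pose P := Measure_isProbability.Build _ _ _ mm m1.
pose mu : probability T R := HB.pack m P M.
by exists mu.
Qed.

Lemma shift_measureE (m : {measure set T -> \bar R}) (s : T -> T) :
  measurable_fun setT s -> (forall E, measurable E -> pushforward m s E = m E) ->
  forall h : T -> \bar R, measurable_fun setT h -> (forall y, 0 <= h y) ->
  \int[m]_x h (s x) = \int[m]_x h x.
Proof.
move=> ms inv h mh h0; rewrite (integral_density (n := m) (q := cst 1%R))//.
  by apply: eq_integral => x _; rewrite mule1.
move=> S mS; rewrite setTI (_ : (fun y => (cst 1%R y)%:E) = cst 1)//.
by rewrite integral_cst// mul1e; exact: inv.
Qed.

End Probability.

(** * Shift-invariant sets are tail sets *)

Section CylinderApproximation.
Context {R : realType} {B : alphabetType}.
Variable nu : probability (full_shift B) R.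
Implicit Types (C E F H : set (full_shift B)) (x y : full_shift B).
Local Open Scope ereal_scope.

Definition window_set k C := forall x y, agree k x y -> C x -> C y.

Lemma measurable_window_set k C : window_set k C -> measurable C.
Proof.
move=> kC; apply: open_measurable_shift; apply/open_agreeP => x Cx.
by exists k => y /kC; exact.
Qed.

Definition approximable E := forall e : R, (0 < e)%R ->
  exists k C, window_set k C /\ nu (E `+` C) < e%:E.

Let measurableY E F : measurable E -> measurable F -> measurable (E `+` F).
Proof. by move=> mE mF; apply: measurableU; exact: measurableD. Qed.

Lemma decreasing_to_empty (F : (set (full_shift B))^nat) (e : R) : (0 < e)%R ->
  (forall n, measurable (F n)) -> (forall n m, (n <= m)%N -> F m `<=` F n) ->
  \bigcap_n F n = set0 -> exists n, nu (F n) < e%:E.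
Proof.
move=> e0 mF dF F0; apply: contrapT => /forallNP nF.
have cF : nu \o F @ \oo --> nu (\bigcap_n F n).
  apply: nonincreasing_cvg_mu => //.
  - by rewrite (le_lt_trans (probability_le1 _ _))// ltry.
  - by rewrite F0.
  - by move=> n m nm; exact/subsetPset/dF.
have : e%:E <= limn (nu \o F).
  apply: lime_ge; first by apply/cvg_ex; eexists; exact: cF.
  by apply: nearW => n /=; rewrite leNgt; apply/negP/nF.
by rewrite (cvg_lim _ cF)// F0 measure0 leNgt lte_fin e0.
Qed.

(** A closed set is the decreasing intersection of the window sets [C k] of points that agree with
    one of its points on the window of size [k]; continuity from above makes the excess small. *)
Lemma approximable_closed E : closed E -> approximable E.
Proof.
move=> cE e e0; pose C k := [set x | exists2 y, E y & agree k x y].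
have kC k : window_set k (C k).
  by move=> x y xy [z Ez xz]; exists z => //; apply: (agree_trans (agree_sym xy)).
have mE := closed_measurable_shift cE.
have mC k : measurable (C k) by exact: measurable_window_set (kC k).
have [k ke] : exists k, nu (C k `\` E) < e%:E.
  apply: decreasing_to_empty => //.
  - by move=> k; exact: measurableD.
  - move=> n m nm x [[y Ey xy] nEx]; split => //; exists y => //.
    exact: agree_leq xy.
  - apply/seteqP; split => // x CE; have [_] := CE 0%N I; apply.
    by move/closed_agreeP : cE; apply => k; have [] := CE k I.
exists k, (C k); split; first exact: kC.
rewrite (_ : E `+` C k = C k `\` E)//; apply/seteqP; split => [x [[Ex nCx]|//]|x ]; last by right.
by exfalso; apply: nCx; exists x.
Qed.

Lemma approximable_setC E : approximable E -> approximable (~` E).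
Proof.
move=> aE e /aE[k [C [kC Ce]]]; exists k, (~` C); split.
  by move=> x y xy nCx Cy; apply: nCx; apply: kC Cy; exact: agree_sym.
rewrite (_ : _ `+` _ = E `+` C)//; apply/seteqP.
by split => x [[/= p q]|[/= p q]]; [right|left|right|left]; split=> //=;
  exact: contrapT.
Qed.

(** Triangle inequality for the measure of symmetric differences. *)
Lemma approximable_half E : measurable E ->
  (forall e : R, (0 < e)%R -> exists F, [/\ measurable F, approximable F &
    nu (E `+` F) < e%:E]) -> approximable E.
Proof.
move=> mE aE e e0; have e20 : (0 < e / 2)%R by rewrite divr_gt0.
have [F [mF aF EF]] := aE _ e20; have [k [C [kC FC]]] := aF _ e20.
have mC := measurable_window_set kC.
exists k, C; split => //; rewrite [e]splitr EFinD.
apply: le_lt_trans (lteD EF FC).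
apply: le_trans (measureU2 _ (measurableY mE mF) (measurableY mF mC)).
apply: le_measure; rewrite ?inE; [exact: measurableY|by apply: measurableU; exact: measurableY|].
move=> x [[Ex nCx]|[Cx nEx]]; have [Fx|nFx] := pselect (F x).
- by right; left.
- by left; left.
- by left; right.
- by right; right.
Qed.

Lemma approximable_setU E F : measurable E -> measurable F ->
  approximable E -> approximable F -> approximable (E `|` F).
Proof.
move=> mE mF aE aF e e0; have e20 : (0 < e / 2)%R by rewrite divr_gt0.
have [k [C [kC EC]]] := aE _ e20; have [l [D [lD FD]]] := aF _ e20.
have mC := measurable_window_set kC; have mD := measurable_window_set lD.
exists (maxn k l), (C `|` D); split.
  move=> x y xy [Cx|Dx]; [left; apply: kC Cx|right; apply: lD Dx].
    by apply: agree_leq xy; exact: leq_maxl.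
  by apply: agree_leq xy; exact: leq_maxr.
rewrite [e]splitr EFinD; apply: le_lt_trans (lteD EC FD).
apply: le_trans (measureU2 _ (measurableY mE mC) (measurableY mF mD)).
apply: le_measure; rewrite ?inE.
- by apply: measurableY; exact: measurableU.
- by apply: measurableU; exact: measurableY.
- move=> x [[[Ex|Fx] /not_orP[nCx nDx]]|[[Cx|Dx] /not_orP[nEx nFx]]].
  + by left; left.
  + by right; left.
  + by left; right.
  + by right; right.
Qed.

Lemma measurable_approximable E : measurable E -> approximable E.
Proof.
rewrite measurable_closedE => mE.
apply: (dynkin_induction (P := approximable) measurable_closedE _ _ _ _ _ mE).
- exact: closedI.
- by apply: approximable_closed; exact: closedT.
- exact: approximable_closed.
- by move=> F _; exact: approximable_setC.
- move=> F mF _ aF; apply: approximable_half => [|e e0]; first exact: bigcup_measurable.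
  (* Partial unions are approximable by finite stability and exhaust the countable union up to small
     measure. *)
  pose G n := \big[setU/set0]_(i < n) F i.
  have mG n : measurable (G n) by exact: bigsetU_measurable.
  have [n Ge] : exists n, nu (\bigcup_n F n `\` G n) < e%:E.
    apply: decreasing_to_empty => //.
    - by move=> n; apply: measurableD => //; exact: bigcup_measurable.
    - move=> n m nm x [Fx nGx]; split => // Gx; apply: nGx.
      move: Gx; rewrite /G -!bigcup_mkord => -[i /= im Fix]; exists i => //=.
      exact: leq_trans nm.
    - apply/seteqP; split => // x FG; have [[n _ Fnx] _] := FG 0%N I.
      have [_] := FG n.+1 I; apply; rewrite /G -bigcup_mkord; by exists n => /=.
  exists (G n); split => //.
    rewrite /G; elim: n {Ge} => [|n ih].
      by rewrite big_ord0; apply: approximable_closed; exact: closed0.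
    by rewrite big_ord_recr/=; apply: approximable_setU => //; exact: (mG n).
  rewrite (_ : _ `+` _ = \bigcup_n F n `\` G n)//.
  apply/seteqP; split => [x [//|[Gx nFx]]|x]; last by left.
  by exfalso; apply: nFx; move: Gx; rewrite /G -bigcup_mkord => -[i _ Fix]; exists i.
Qed.

End CylinderApproximation.

(** * Borel-Cantelli and constancy of invariant functions on Gibbs classes *)

Section Tail.
Context {R : realType} {B : alphabetType}.
Variables (nu : probability (full_shift B) R) (Y : set (full_shift B)).
Hypotheses (mY : measurable Y) (inv_nu : shift_invariant nu).
Hypothesis nonsing_nu : gibbs_nonsingular Y nu.
Local Open Scope ereal_scope.

Lemma measurable_shift_map : measurable_fun setT (@shift_map B).
Proof. exact: measurable_shift_by. Qed.

Lemma measurable_shift_preimage n (E : set (full_shift B)) :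
  measurable E -> measurable (shift_by n @^-1` E).
Proof. by move=> mE; rewrite -[X in measurable X]setTI; exact: measurable_shift_by. Qed.

Lemma shift_invariant_iter (j : nat) (E : set (full_shift B)) :
  measurable E -> nu (shift_by j%:Z @^-1` E) = nu E.
Proof.
elim: j E => [|j ih] E mE.
  by congr (nu _); apply/seteqP; split=> x; rewrite /preimage/= shift_by0.
rewrite -[RHS]inv_nu// /pushforward -[RHS]ih; last exact: measurable_shift_preimage.
by congr (nu _); apply/seteqP; split=> x; rewrite /preimage/= /shift_map shift_by_add intS.
Qed.

(** By invariance of [H] and [nu], a window set close to [H] stays equally close after a shift.
    Outside a null set, membership in [H] is therefore eventually decided by windows arbitrarily far
    to the right, where equivalent points agree. *)
Lemma invariant_set_tail (H : set (full_shift B)) : measurable H ->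
  (forall x, H (shift_map x) <-> H x) ->
  nu.-negligible [set x | exists y, gibbs_rel Y x y /\ ~ (H x <-> H y)].
Proof.
move=> mH invH.
have invHj (j : nat) x : H (shift_by j%:Z x) <-> H x.
  elim: j x => [|j ih] x; first by rewrite shift_by0.
  by rewrite intS -shift_by_add -/(shift_map _) invH.
have e0 (m : nat) : (0 < 1 / (2 ^ m.+1)%:R :> R)%R by rewrite divr_gt0// ltr0n expn_gt0.
have /choice[kC kCP] : forall m : nat, exists kC : nat * set (full_shift B),
    window_set kC.1 kC.2 /\ nu (H `+` kC.2) < (1 / (2 ^ m.+1)%:R)%:E.
  move=> m; have [k [C kC]] := measurable_approximable nu mH (e0 m).
  by exists (k, C).
(* Shifting by [j m] moves every coordinate of the window of the [m]-th approximant to a position at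
   least [m]. *)
pose j m := (m + \max_(i < (kC m).1)
  odflt 0%N (omap (fun n : int => `|n|%N) (unpickle i)))%N.
pose bad m := shift_by (j m)%:Z @^-1` (H `+` (kC m).2).
have mbad m : measurable (bad m).
  apply: measurable_shift_preimage.
  have mC := measurable_window_set (kCP m).1.
  by apply: measurableU; exact: measurableD.
have le_bad m : nu (bad m) <= (1 / (2 ^ m.+1)%:R)%:E.
  rewrite /bad shift_invariant_iter; first exact/ltW/(kCP m).2.
  have mC := measurable_window_set (kCP m).1.
  by apply: measurableU; exact: measurableD.
pose L := lim_sup_set bad.
have mL : measurable L.
  by apply: bigcap_measurable => // n _; exact: bigcup_measurable.
have L0 : nu L = 0.
  (* Borel-Cantelli: the errors are bounded by [1 / 2 ^ (m + 1)], whose sum is at most 1. *)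
  apply: lim_sup_set_cvg0 => //; apply: (@le_lt_trans _ _ 1%:E); last exact: ltry.
  apply: le_trans (epsilon_trick0 xpredT ler01).
  by apply: lee_nneseries => // m _; exact: le_bad.
have mLY : measurable (L `&` Y) by exact: measurableI.
have mS : measurable (saturation Y (L `&` Y)).
  by apply: measurable_saturation => // x [].
have nL : nu.-negligible L by exists L; split.
(* By nonsingularity almost no point has an equivalent point in [L], so both members of a pair can
   be kept out of [L]. *)
have S0 : nu (saturation Y (L `&` Y)) = 0.
  apply: nonsing_nu => //; apply: measure_negligible => //.
  by apply: negligibleS nL => x [].
have nS : nu.-negligible (saturation Y (L `&` Y)).
  by exists (saturation Y (L `&` Y)); split.
apply: negligibleS (negligibleU nL nS) => x [y [xy Hxy]].
apply: contrapT => /not_orP[nLx nSx]; apply: Hxy.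
have nLy : ~ L y.
  move=> Ly; apply: nSx; exists y; last exact: gibbs_rel_sym.
  by split => //; case: xy.
have ev z : ~ L z -> exists n, forall m, (n <= m)%N -> ~ bad m z.
  move=> nLz; apply: contrapT => /forallNP nz; apply: nLz => n _.
  by have /existsNP[m /not_implyP[nm /contrapT bz]] := nz n; exists m.
have [a aP] := ev _ nLx; have [b bP] := ev _ nLy.
have [_ _ [N _ xyN]] := xy.
(* From [a] and [b] on neither point is bad, and [m > N] puts the shifted window where [x] and [y]
   agree. *)
pose m := maxn N.+1 (maxn a b).
have badE z : ~ bad m z -> (H z <-> (kC m).2 (shift_by (j m)%:Z z)).
  rewrite /bad/= => /not_orP[/= n1 n2]; split => [Hz|Cz]; apply: contrapT => n3.
    by apply: n1; split => //; exact/invHj.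
  by apply: n2; split => // /invHj.
have mx : ~ bad m x by apply: aP; rewrite /m; lia.
have my : ~ bad m y by apply: bP; rewrite /m; lia.
have ag : agree (kC m).1 (shift_by (j m)%:Z x) (shift_by (j m)%:Z y).
  move=> n nk; rewrite /shift_by; apply: xyN.
  have := @leq_bigmax _ (fun i : 'I_(kC m).1 =>
    odflt 0%N (omap (fun n : int => `|n|%N) (unpickle i))) (Ordinal nk).
  rewrite /= pickleK/= /j; set M := (\max_(i < _) _)%N.
  have : (N < m)%N by rewrite /m; lia.
  by move: (m) (M) => m' M'; lia.
rewrite (badE _ mx) (badE _ my); split; apply: (kCP m).1 => //.
exact: agree_sym.
Qed.

(** The countably many level sets of [v] are invariant, and two points with different values are
    separated by one of them. *)
Lemma invariant_count_tail (v : full_shift B -> \bar R) : measurable_fun setT v ->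
  (forall y, exists n : nat, v y = n%:R%:E) -> (forall y, v (shift_map y) = v y) ->
  nu.-negligible [set x | exists y, gibbs_rel Y x y /\ v x <> v y].
Proof.
move=> mv natv invv.
have negn (n : nat) : nu.-negligible [set x | exists y, gibbs_rel Y x y /\
    ~ (v x = n%:R%:E <-> v y = n%:R%:E)].
  apply: (@invariant_set_tail [set x | v x = n%:R%:E]) => [|x /=]; last by rewrite invv.
  rewrite (_ : mkset _ = setT `&` v @^-1` [set n%:R%:E]); last by rewrite setTI.
  exact: mv.
apply: negligibleS (negligible_bigcup negn) => x [y [xy vxy]].
have [n vn] := natv x; exists n => //; exists y; split => //.
by rewrite vn => -[/(_ erefl) vy _]; apply: vxy; rewrite vy.
Qed.

End Tail.

(** * Lifting the measure *)

Section HolonomyPieces.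
Context {R : realType} {B : alphabetType}.
Variables (Y : set (full_shift B)) (nu : probability (full_shift B) R).
Variable phi : full_shift B -> full_shift B -> R.
Hypotheses (mY : measurable Y) (gibbs_nu : gibbs_measure Y phi nu).
Local Open Scope ereal_scope.

(* For words u and v of the same size, overlay v is a holonomy from
   exchangeable u v to exchangeable v u, with inverse overlay u. *)
Definition exchangeable (u v : seq B) : set (full_shift B) :=
  [set y | [/\ Y y, cylinder u y & Y (overlay v y)]].

Lemma measurable_exchangeable u v : measurable (exchangeable u v).
Proof.
rewrite (_ : exchangeable u v = Y `&` (cylinder u `&` overlay v @^-1` Y)).
  apply: measurableI => //; apply: measurableI; first exact: measurable_cylinder.
  exact: measurable_overlay_preimage.
by apply/seteqP; split => [y []|y [? []]].
Qed.

Lemma overlay_exchangeable u v y : size u = size v ->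
  exchangeable u v y -> exchangeable v u (overlay v y) /\ overlay u (overlay v y) = y.
Proof.
move=> uv [Yy uy Yvy]; have uvy : overlay u (overlay v y) = y.
  by rewrite overlay_overlay ?uv// cylinder_overlay.
by split => //; split => //; [exact: cylinder_overlaid|rewrite uvy].
Qed.

Lemma overlay_image u v F : size u = size v -> F `<=` exchangeable u v ->
  overlay v @` F = exchangeable v u `&` overlay u @^-1` F.
Proof.
move=> uv FD; apply/seteqP; split => [_ [y Fy <-]|y [vuy Fuy]].
  by have [vuy uvy] := overlay_exchangeable uv (FD _ Fy); split => //=; rewrite uvy.
by exists (overlay u y) => //; have [] := overlay_exchangeable (esym uv) vuy.
Qed.

Lemma holonomy_overlay u v : size u = size v ->
  holonomy Y (exchangeable u v) (exchangeable v u) (overlay v).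
Proof.
move=> uv; split.
- by split; [exact: measurable_exchangeable..|move=> y []|move=> y []].
- split.
  + by move=> y /(overlay_exchangeable uv)[].
  + move=> y z /set_mem/(overlay_exchangeable uv)[_ uvy].
    by move=> /set_mem/(overlay_exchangeable uv)[_ uvz] yz; rewrite -uvy yz.
  + by move=> y vuy; exists (overlay u y); have [] := overlay_exchangeable (esym uv) vuy.
- by apply: measurable_funTS; exact: measurable_overlay.
- move=> F mF FD; rewrite (overlay_image uv)//; apply: measurableI.
    exact: measurable_exchangeable.
  exact: measurable_overlay_preimage.
- by move=> y [Yy _ Yvy]; exact: gibbs_rel_overlay.
Qed.

(** Turns the Radon-Nikodym derivative of a word rewriting, given only on its domain, into a
    nonnegative real density on the whole space. Measurability of [q] comes from that derivative,
    and the exponential formula is kept only almost everywhere. *)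
Lemma overlay_density u v : size u = size v -> exists q : full_shift B -> R,
  [/\ measurable_fun setT q, (forall y, (0 <= q y)%R),
    (forall y, ~ exchangeable u v y -> q y = 0%R),
    (forall h : full_shift B -> \bar R, measurable_fun setT h -> (forall y, 0 <= h y) ->
      \int[nu]_(y in exchangeable v u) h (overlay u y) = \int[nu]_y (h y * (q y)%:E)) &
    nu.-negligible [set y | exchangeable u v y /\ q y <> expR (phi y (overlay v y))]].
Proof.
move=> uv; have [_ _ /(_ _ _ _ (holonomy_overlay uv))] := gibbs_nu.
move=> [g [ig gE] gae]; set D := exchangeable u v in ig gE gae *.
have mD : measurable D by exact: measurable_exchangeable.
have mg : measurable_fun D g by case/integrableP : ig.
(* Almost everywhere on [D] the derivative is an exponential, so [fine] and the absolute value alter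
   it on a null set only. *)
pose q := (fun y => `|fine (g y)|%R) \_ D.
have mq : measurable_fun setT q.
  apply/(measurable_restrictT _ _).1 => //; apply: measurableT_comp => //.
  exact: measurableT_comp.
have qD y : D y -> q y = `|fine (g y)|%R by move=> Dy; rewrite /q patchE mem_set.
have q0 y : ~ D y -> q y = 0%R by move=> nDy; rewrite /q patchE memNset.
have q_ge0 y : (0 <= q y)%R by rewrite /q patchE; case: ifP.
exists q; split => //; last first.
  apply: negligibleS gae => y [Dy qy] /=; apply: contra_not qy => /(_ Dy) gy.
  by rewrite qD// gy/= ger0_norm// expR_ge0.
move=> h mh h0; apply: integral_density => //; first exact: measurable_exchangeable.
  exact: measurable_overlay.
move=> S mS; have mDS : measurable (D `&` S) by exact: measurableI.
transitivity (nu (overlay v @` (D `&` S))).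
  congr (nu _); rewrite (overlay_image uv); last by move=> y [].
  apply/seteqP; split => [y [vuy Suy]|y [vuy [_ Suy]]]; split => //.
  by split => //; have [] := overlay_exchangeable (esym uv) vuy.
rewrite gE//.
transitivity (\int[nu]_(y in D `&` S) (q y)%:E).
  apply: ae_eq_integral => //.
  - by apply: measurable_funS mg => // y [].
  - by apply: measurable_funTS; exact/measurable_EFinP.
  - apply: negligibleS gae => y /= gy Dg; apply: gy => -[Dy _].
    by rewrite qD// (Dg Dy)/= ger0_norm ?expR_ge0.
rewrite [LHS]integral_mkcond [RHS]integral_mkcond; apply: eq_integral => y _.
rewrite !patchE in_setI; have [Dy|nDy] := pselect (D y); first by rewrite (mem_set Dy).
by rewrite memNset//= q0//; case: ifP.
Qed.

End HolonomyPieces.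

(** * The lifted measure: uniform distribution on fibres, averaged over [nu] *)

Section Lift.
Context {R : realType} {A B : alphabetType}.
Variables (X : set (full_shift A)) (Y : set (full_shift B)).
Variables (pi : full_shift A -> full_shift B) (nu : probability (full_shift B) R).
Hypotheses (shiftX : shift_space X) (shiftY : shift_space Y).
Hypotheses (cont_pi : {within X, continuous pi}) (image_pi : pi @` X = Y).
Hypothesis shift_pi : forall x, X x -> pi (shift_map x) = shift_map (pi x).
Hypothesis finite_fibre : forall y, finite_set (X `&` pi @^-1` [set y]).
Hypotheses (nuY : nu Y = 1%E) (inv_nu : shift_invariant nu).
Hypothesis nonsing_nu : gibbs_nonsingular Y nu.
Local Open Scope ereal_scope.

Local Notation count := (@fibre_count R A B X pi).

Let mX : measurable X. Proof. exact: closed_measurable_shift shiftX.1. Qed.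
Let mY : measurable Y. Proof. exact: closed_measurable_shift shiftY.1. Qed.
Let mpi : measurable_fun X pi.
Proof. exact: within_continuous_measurable shiftX.1 cont_pi. Qed.
Let piY x : X x -> Y (pi x). Proof. by move=> Xx; rewrite -image_pi; exists x. Qed.

(* Off Y both counts vanish, and the quotient is 0. *)
Definition fibre_mass (E : set (full_shift A)) (y : full_shift B) : R :=
  (fine (count E y) / fine (count setT y))%R.

Lemma fine_count_ge0 E y : (0 <= fine (count E y))%R.
Proof. by rewrite fine_ge0// counting_ge0. Qed.

Lemma fibre_mass_ge0 E y : (0 <= fibre_mass E y)%R.
Proof. by rewrite divr_ge0// fine_count_ge0. Qed.

Lemma measurable_fibre_mass E : measurable E -> measurable_fun setT (fibre_mass E).
Proof.
have mc F : measurable F -> measurable_fun setT (fine \o count F).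
  move=> mF; apply: measurableT_comp => //.
  exact: measurable_fun_fibre_count shiftX.1 cont_pi mF.
(* The inverse is written as the power with exponent -1, whose measurability is known; the two agree
   on nonnegative reals, including 0. *)
move=> mE; rewrite (_ : fibre_mass E = fun y =>
  (fine (count E y) * fine (count setT y) `^ (- 1))%R); last first.
  by apply/funext => y; rewrite powR_inv1// fine_count_ge0.
apply: measurable_funM; first exact: mc.
exact: (measurableT_comp (@measurable_powR R (- 1)%R) (mc _ measurableT)).
Qed.

Lemma fibre_count_setT_neq0 y : Y y -> count setT y != 0.
Proof.
rewrite -image_pi => -[x Xx xy]; apply/eqP => /counting_eq0; apply/eqP/set0P.
by exists x.
Qed.

Lemma fibre_mass_count0 E y : count E y = 0 -> fibre_mass E y = 0%R.
Proof. by rewrite /fibre_mass => ->; rewrite mul0r. Qed.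

Lemma fibre_mass_eq0 E y : fibre_mass E y = 0%R -> count E y = 0.
Proof.
have [Yy|nYy] := pselect (Y y).
  move=> /eqP; rewrite mulf_eq0 invr_eq0 !fine_eq0 ?fibre_count_fin_num//.
  by rewrite (negbTE (fibre_count_setT_neq0 Yy)) orbF => /eqP.
move=> _; apply/counting_eq0; apply/seteqP; split=> // x [[Xx xy] _].
by apply: nYy; rewrite -xy; exact: piY.
Qed.

Lemma fibre_mass0P E y : (forall x, X x -> pi x = y -> ~ E x) -> fibre_mass E y = 0%R.
Proof.
move=> xE; apply: fibre_mass_count0; apply/counting_eq0; apply/seteqP; split=> // x.
by move=> [[Xx xy] Ex]; exact: xE Ex.
Qed.

Lemma fibre_mass_bigcup (F : (set (full_shift A))^nat) y :
  (forall n, measurable (F n)) -> trivIset setT F ->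
  (fibre_mass (\bigcup_n F n) y)%:E = \sum_(0 <= n <oo) (fibre_mass (F n) y)%:E.
Proof.
move=> mF tF; rewrite /fibre_mass EFinM muleC fineK ?fibre_count_fin_num//.
rewrite fibre_count_bigcup// -nneseriesZl//.
by apply: eq_eseriesr => n _; rewrite muleC -[in LHS](fineK (fibre_count_fin_num _ _ _))// -EFinM.
Qed.

Lemma fibre_mass_cover (E : set (full_shift A)) y : (forall x, X x -> pi x = y -> E x) ->
  fibre_mass E y = \1_Y y.
Proof.
move=> yE; have cE : count E y = count setT y.
  congr counting; apply/seteqP; split => x [[Xx xy] _]; split => //; exact: yE.
rewrite /fibre_mass cE indicE; have [Yy|nYy] := pselect (Y y).
  by rewrite (mem_set Yy) divff// fine_eq0 ?fibre_count_fin_num// fibre_count_setT_neq0.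
rewrite memNset// (_ : count setT y = 0) ?mul0r//.
apply/counting_eq0; apply/seteqP; split=> // x [[Xx xy] _].
by apply: nYy; rewrite -xy; exact: piY.
Qed.

(** The shift is a bijection from the fibre over [y] onto the fibre over [shift_map y]. *)
Lemma fibre_count_shift E y :
  count (shift_map @^-1` E) y = count E (shift_map y).
Proof.
rewrite /fibre_count -(@counting_image R _ _ (@shift_map A)).
- congr counting; apply/seteqP; split => [_ [x [[Xx /= xy] Ex] <-]|x [[Xx /= xy] Ex]].
    by split => //; split; [exact/shift_space_shift_map|rewrite /= shift_pi// xy].
  have [_ sX] := shiftX; move: (Xx); rewrite -{1}sX => -[z Xz zx].
  exists z => //; split; last by rewrite /= zx.
  split => //=; move: xy; rewrite -zx shift_pi// => /(congr1 (shift_by (-1))).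
  by rewrite /shift_map !shift_by_add addNr !shift_by0.
- by apply: sub_finite_set (finite_fibre y) => x [].
- move=> x z _ _ /(congr1 (shift_by (-1))).
  by rewrite /shift_map !shift_by_add addNr !shift_by0.
Qed.

Lemma fibre_mass_shift E y :
  fibre_mass (shift_map @^-1` E) y = fibre_mass E (shift_map y).
Proof. by rewrite /fibre_mass -!fibre_count_shift. Qed.

Lemma lift_exists : exists mu : probability (full_shift A) R,
  forall E, mu E = \int[nu]_y (fibre_mass E y)%:E.
Proof.
apply: probability_exists.
- apply: integral0_eq => y _; rewrite fibre_mass0P// => x _ _ [].
- by move=> E; apply: integral_ge0 => y _; rewrite lee_fin fibre_mass_ge0.
- move=> F mF tF mUF.
  under [X in _ --> X]eq_integral do rewrite fibre_mass_bigcup//.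
  rewrite integral_nneseries//.
  + apply: is_cvg_nneseries => n _ _.
    by apply: integral_ge0 => y _; rewrite lee_fin fibre_mass_ge0.
  + by move=> n; apply/measurable_EFinP; exact: measurable_fibre_mass.
  + by move=> n y _; rewrite lee_fin fibre_mass_ge0.
- under eq_integral do rewrite fibre_mass_cover//.
  by rewrite integral_indic// setIT.
Qed.

Section LiftedMeasure.
Variable mu : probability (full_shift A) R.
Hypothesis muE : forall E, mu E = \int[nu]_y (fibre_mass E y)%:E.

Let measurable_preimage (S : set (full_shift B)) : measurable S ->
  measurable (X `&` pi @^-1` S).
Proof. by move=> mS; exact: mpi. Qed.

(** The preimage of [S] contains all of a nonempty fibre or none of it, so its mass is the indicator
    of the intersection of [S] and [Y], and [Y] has full measure. *)
Lemma lift_pushes_to : pushes_to X pi mu nu.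
Proof.
move=> S mS; rewrite muE.
transitivity (\int[nu]_y (\1_(S `&` Y) y)%:E).
  apply: eq_integral => y _; congr EFin.
  have [Sy|nSy] := pselect (S y).
    rewrite fibre_mass_cover => [|x Xx xy]; last by split => //=; rewrite xy.
    by rewrite !indicE in_setI (mem_set Sy).
  rewrite fibre_mass0P => [|x Xx xy [_]]; last by rewrite /= xy.
  by rewrite indicE in_setI memNset.
rewrite integral_indic ?setIT//; last exact: measurableI.
have nY0 : nu (~` Y) = 0 by rewrite probability_setC// nuY subee.
transitivity (nu ((S `&` Y) `|` (S `&` ~` Y))); last first.
  by rewrite -setIUr setUv setIT.
rewrite measureU//.
- rewrite [X in _ + X](_ : _ = 0) ?adde0//; apply/eqP.
  rewrite eq_le measure_ge0 andbT -nY0 le_measure ?inE//.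
  + by apply: measurableI => //; exact: measurableC.
  + exact: measurableC.
- exact: measurableI.
- by apply: measurableI => //; exact: measurableC.
- by apply/seteqP; split => // x [[_ Yx] [_]].
Qed.

Lemma lift_space : mu X = 1.
Proof.
by rewrite -[X in mu X]setIT -(preimage_setT pi) lift_pushes_to// probability_setT.
Qed.

Lemma lift_negligible (Z : set (full_shift B)) :
  nu.-negligible Z -> mu.-negligible (X `&` pi @^-1` Z).
Proof.
move=> [S [mS S0 ZS]]; exists (X `&` pi @^-1` S); split.
- exact: measurable_preimage.
- by rewrite lift_pushes_to.
- by move=> x [Xx Zx]; split => //; exact: ZS.
Qed.

Lemma lift_shift_invariant : shift_invariant mu.
Proof.
move=> E mE; rewrite /pushforward !muE.
under eq_integral do rewrite fibre_mass_shift.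
apply: (shift_measureE (@measurable_shift_map B) inv_nu
  (h := fun y => (fibre_mass E y)%:E)).
  by apply/measurable_EFinP; exact: measurable_fibre_mass.
by move=> y; rewrite lee_fin fibre_mass_ge0.
Qed.

(** If [E] is null, the set [Q] of points of [Y] whose fibre meets [E] is null, hence so is its
    saturation. Since [pi] preserves the Gibbs relation, the saturation of [E] lies over that of
    [Q]. *)
Lemma lift_nonsingular : gibbs_nonsingular X mu.
Proof.
move=> E mE EX; rewrite !muE => E0.
have mfE : measurable_fun setT (fun y => (fibre_mass E y)%:E).
  by apply/measurable_EFinP; exact: measurable_fibre_mass.
pose Q := Y `&` [set y | (fibre_mass E y)%:E != 0].
have mQ : measurable Q.
  apply: measurableI => //; rewrite (_ : mkset _ =
    ~` ((fun y => (fibre_mass E y)%:E) @^-1` [set 0])).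
    by apply: measurableC; rewrite -[X in measurable X]setTI; exact: mfE.
  by apply/seteqP; split => y /= /eqP.
have Q0 : nu Q = 0.
  apply: measure_negligible => //.
  have /(ae_eq_integral_abs nu measurableT mfE).1 :
      \int[nu]_y `|(fibre_mass E y)%:E| = 0.
    by under eq_integral do rewrite gee0_abs ?lee_fin ?fibre_mass_ge0//.
  apply: negligibleS => y [_ /= /eqP yE] /= yE0.
  exact/yE/yE0.
have S0 := nonsing_nu mQ (@subIsetl _ _ _) Q0.
have negS : nu.-negligible (saturation Y Q).
  exists (saturation Y Q); split => //.
  by apply: measurable_saturation => //; exact: subIsetl.
rewrite (ge0_ae_eq_integral (g := cst 0)) ?integral0//.
- apply/measurable_EFinP; apply: measurable_fibre_mass.
  exact: measurable_saturation.
- by move=> y _; rewrite lee_fin fibre_mass_ge0.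
- apply: negligibleS negS => y /= /not_implyP[_ yS].
  apply: contrapT => nSy; apply: yS; rewrite fibre_mass0P// => z Xz zy [x Ex xz].
  apply: nSy; exists (pi x).
    split; first exact/piY/EX.
    apply/eqP => -[/fibre_mass_eq0/counting_eq0 x0].
    have : (X `&` pi @^-1` [set pi x] `&` E) x by split => //; split => //; exact: EX.
    by rewrite x0.
  rewrite -zy; apply: (code_gibbs_rel shiftX shift_pi cont_pi _ xz).
  by rewrite image_pi.
Qed.

Lemma lift_integral (F : set (full_shift A)) (h : full_shift B -> \bar R) :
  measurable F -> F `<=` X -> measurable_fun setT h -> (forall y, 0 <= h y) ->
  \int[mu]_(x in F) h (pi x) = \int[nu]_y (h y * (fibre_mass F y)%:E).
Proof.
(* Extending [pi] by a constant outside [X] gives a map measurable on the whole space. *)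
move=> mF FX mh h0; pose p x := if x \in X then pi x else point.
transitivity (\int[mu]_(x in F) h (p x)).
  by apply: eq_integral => x /set_mem/FX Xx; rewrite /p mem_set.
apply: integral_density => //.
- rewrite -(setUv X); apply/measurable_funU => //; first exact: measurableC.
  split; [apply: (eq_measurable_fun pi) => // x xX; rewrite /p xX//|].
  apply: (eq_measurable_fun (cst point)) => // x /set_mem nXx.
  by rewrite /p memNset.
- exact: measurable_fibre_mass.
- by move=> y; exact: fibre_mass_ge0.
- move=> S mS; transitivity (\int[nu]_y (fibre_mass (F `&` p @^-1` S) y)%:E).
    exact: muE.
  rewrite [RHS]integral_mkcond; apply: eq_integral => y _.
  rewrite patchE; case: ifPn => [/set_mem Sy|/negP/(contra_not (@mem_set _ _ _)) nSy].
    congr (_%:E); rewrite /fibre_mass; congr (fine _ / _)%R; congr counting.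
    apply/seteqP; split => [x [[Xx xy] [Fx _]]//|x [[Xx xy] Fx]].
    by split => //; split => //=; rewrite /p mem_set// xy.
  rewrite fibre_mass0P// => x Xx xy [_]; rewrite /= /p mem_set// xy.
  exact: nSy.
Qed.

(** * The Gibbs property of the lifted measure *)

Section LiftedGibbs.
Variable f : full_shift B -> R.
Hypothesis gibbs_nu : gibbs_measure_for Y f nu.

Lemma fibre_count_natural E y : exists n : nat, count E y = n%:R%:E.
Proof.
have [n En] : finite_set (X `&` pi @^-1` [set y] `&` E).
  by apply: sub_finite_set (finite_fibre y) => x [].
by exists n; exact: counting_card.
Qed.

(** The size of the fibre is measurable, natural-valued and shift-invariant, so almost every point
    has the same fibre size as all points equivalent to it. *)
Lemma fibre_count_tail : nu.-negligible
  [set y | exists z, gibbs_rel Y y z /\ count setT y <> count setT z].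
Proof.
apply: (invariant_count_tail mY inv_nu nonsing_nu).
- exact: measurable_fun_fibre_count shiftX.1 cont_pi measurableT.
- exact: fibre_count_natural.
- by move=> y; rewrite -fibre_count_shift.
Qed.

(** [psi] carries the part of [F] over [y] bijectively onto the part of its image over
    [overlay v y]: nothing comes from another fibre, because [overlay v] is injective on the
    cylinder of [u]. *)
Lemma fibre_count_piece u v psi F y : size u = size v -> F `<=` X ->
  set_inj F psi ->
  (forall x, F x -> [/\ X (psi x), cylinder u (pi x) & pi (psi x) = overlay v (pi x)]) ->
  cylinder u y -> count (psi @` F) (overlay v y) = count F y.
Proof.
move=> uv FX psiI psiP uy.
have ovK z : cylinder u z -> overlay u (overlay v z) = z.
  by move=> uz; rewrite overlay_overlay ?uv// cylinder_overlay.
rewrite /fibre_count -[RHS](@counting_image R _ _ psi).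
- congr counting; apply/seteqP; split=> [z [[_ /= zy] [x Fx xz]]|_ [x [[Xx /= xy] Fx] <-]].
    have [Xpx ux pix] := psiP _ Fx; exists x => //; split => //; split; first exact: FX.
    by rewrite /= -(ovK _ ux) -(ovK _ uy) -pix xz zy.
  have [Xpx ux pix] := psiP _ Fx.
  by split; [split => //; rewrite /= pix xy|exists x].
- by apply: sub_finite_set (finite_fibre y) => x [].
- by move=> x z /set_mem[_ Fx] /set_mem[_ Fz]; apply: psiI; exact: mem_set.
Qed.

(** The Gibbs identity on a piece where [psi] lies over a single word rewriting: integrate the fibre
    mass of the image of [F], change variables in [Y], and compare the two masses. *)
Lemma lift_piece u v psi F (q : full_shift B -> R) :
  size u = size v -> measurable F -> measurable (psi @` F) -> F `<=` X -> set_inj F psi ->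
  (forall x, F x -> [/\ X (psi x), cylinder u (pi x) & pi (psi x) = overlay v (pi x)]) ->
  measurable_fun setT q -> (forall y, (0 <= q y)%R) ->
  (forall y, ~ exchangeable Y u v y -> q y = 0%R) ->
  (forall h : full_shift B -> \bar R, measurable_fun setT h -> (forall y, 0 <= h y) ->
    \int[nu]_(y in exchangeable Y v u) h (overlay u y) = \int[nu]_y (h y * (q y)%:E)) ->
  mu (psi @` F) = \int[mu]_(x in F) (q (pi x))%:E.
Proof.
move=> uv mF mpsiF FX psiI psiP mq q0 qD qE.
have mfpsi := measurable_fibre_mass mpsiF; have mfF := measurable_fibre_mass mF.
pose h y := (fibre_mass (psi @` F) (overlay v y))%:E.
have mh : measurable_fun setT h.
  apply/measurable_EFinP; apply: (measurableT_comp mfpsi).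
  exact: measurable_overlay.
rewrite muE (lift_integral (h := fun y => (q y)%:E))//; last exact/measurable_EFinP.
(* The image of [F] lies over [exchangeable Y v u], where [overlay v] undoes [overlay u]; elsewhere
   its fibre mass is 0. *)
transitivity (\int[nu]_(y in exchangeable Y v u) h (overlay u y)).
  rewrite [RHS]integral_mkcond; apply: eq_integral => y _; rewrite patchE.
  case: ifPn => [/set_mem vuy|/negP nvuy].
    by rewrite /h; have [_ ->] := overlay_exchangeable (esym uv) vuy.
  rewrite fibre_mass0P// => z _ zy [x Fx xz]; apply: nvuy; apply/mem_set.
  have [Xpx ux pix] := psiP _ Fx.
  rewrite -zy -xz pix; apply: (overlay_exchangeable uv _).1; split => //.
    exact/piY/FX.
  by rewrite -pix; exact: piY.
rewrite qE//; last by move=> y; rewrite lee_fin fibre_mass_ge0.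
apply: ge0_ae_eq_integral => //.
- by apply: emeasurable_funM => //; exact/measurable_EFinP.
- by apply: emeasurable_funM => //; exact/measurable_EFinP.
- by move=> y _; rewrite mule_ge0// lee_fin// fibre_mass_ge0.
- by move=> y _; rewrite mule_ge0// lee_fin// fibre_mass_ge0.
(* Where [q] is not forced to vanish, the numerators agree by [fibre_count_piece]; the denominators
   agree off the null set of points with an equivalent point of different fibre size. *)
- apply: negligibleS fibre_count_tail => y /= hy; apply: contrapT => ny.
  apply: hy => _; rewrite muleC.
  have [[Yy uy Yvy]|/qD->] := pselect (exchangeable Y u v y); last by rewrite !mul0e.
  congr (_ * _%:E); rewrite /fibre_mass (fibre_count_piece uv FX psiI psiP uy).
  congr (_ / fine _)%R; apply: contrapT => nvy; apply: ny; exists (overlay v y).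
  by split; [exact: gibbs_rel_overlay|exact/nesym].
Qed.

(** The domain splits into countably many pieces, one for each pair of words exchanged below by the
    holonomy. The derivative is glued from the densities of these rewritings composed with [pi]. *)
Lemma lift_gibbs : gibbs_measure_for X (f \o pi) mu.
Proof.
split; [exact: lift_space|exact: lift_nonsingular|].
move=> D E psi [[mD mE DX EX] [psiDE psiI psiS] mpsi psiM psiT].
(* Enumerates all pairs of words; an index that codes no pair harmlessly repeats the pair of empty
   words. *)
pose uv (i : nat) : seq B * seq B := odflt ([::], [::]) (unpickle i).
have /choice[q qP] : forall i : nat, exists q : full_shift B -> R,
    size (uv i).1 = size (uv i).2 -> [/\ measurable_fun setT q,
    (forall y, (0 <= q y)%R),
    (forall y, ~ exchangeable Y (uv i).1 (uv i).2 y -> q y = 0%R),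
    (forall h : full_shift B -> \bar R, measurable_fun setT h -> (forall y, 0 <= h y) ->
      \int[nu]_(y in exchangeable Y (uv i).2 (uv i).1) h (overlay (uv i).1 y) =
      \int[nu]_y (h y * (q y)%:E)) &
    nu.-negligible [set y | exchangeable Y (uv i).1 (uv i).2 y /\
      q y <> expR (potential_cocycle f y (overlay (uv i).2 y))]].
  move=> i; have [suv|nsuv] := pselect (size (uv i).1 = size (uv i).2); last first.
    by exists (cst 0%R).
  by have [q qP] := overlay_density mY gibbs_nu suv; exists q.
pose P i := [set x | [/\ D x, size (uv i).1 = size (uv i).2, cylinder (uv i).1 (pi x) &
  pi (psi x) = overlay (uv i).2 (pi x)]].
have mpiD : measurable_fun D pi by exact: measurable_funS mpi.
have mpipsi : measurable_fun D (pi \o psi).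
  by apply: (measurable_comp (F := X)) => // _ [x Dx <-]; exact/EX/psiDE.
have mP i : measurable (P i).
  have [suv|nsuv] := pselect (size (uv i).1 = size (uv i).2); last first.
    by rewrite (_ : P i = set0)//; apply/seteqP; split => // x [].
  rewrite (_ : P i = (D `&` pi @^-1` cylinder (uv i).1) `&`
     (D `&` [set x | (pi \o psi) x = (overlay (uv i).2 \o pi) x])).
    apply: measurableI; first by apply: mpiD => //; exact: measurable_cylinder.
    apply: measurable_eq_fun_shift => //.
    by apply: measurableT_comp => //; exact: measurable_overlay.
  by apply/seteqP; split => [x [Dx _ ux ox]|x [[Dx ux] [_ ox]]].
(* The images of [x] and [psi x] are Gibbs-equivalent, hence differ inside one window, and their
   words there give the index. *)
have covP x : D x -> exists i, P i x.
  move=> Dx.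
  have xT : gibbs_rel Y (pi x) (pi (psi x)).
    by apply: (code_gibbs_rel shiftX shift_pi cont_pi _ (psiT _ Dx)); rewrite image_pi.
  have [k /(_ _ (leqnn k)) kx] := gibbs_rel_overlayP xT.
  exists (pickle (word k (pi x), word k (pi (psi x)))).
  rewrite /P/= /uv pickleK/= !size_word; split => //; exact: cylinder_word.
pose P' := seqDU P.
have P'P i : P' i `<=` P i by exact: subset_seqDU.
have P'D i : P' i `<=` D by move=> x /P'P[].
have mP' i : measurable (P' i) by exact: seqDU_measurable.
have tP' : trivIset setT P' by exact: trivIset_seqDU.
have covP' : \bigcup_i P' i = D.
  rewrite -[LHS]seqDU_bigcup_eq; apply/seteqP; split => [x [i _ []]//|x Dx].
  by have [i Pi] := covP _ Dx; exists i.
(* The pieces are disjoint, so this is the index of the one containing [x]; the default 0 is met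
   only outside [D]. *)
pose idx x := xget 0%N [set i | P' i x].
have idxE i x : P' i x -> idx x = i.
  move=> P'x; have P'idx : P' (idx x) x by apply: (@xgetPex _ 0%N [set i | P' i x]); exists i.
  by apply: (tP' _ _ I I); exists x.
have P'uv i x : P' i x -> size (uv i).1 = size (uv i).2 by move=> /P'P[].
pose g x := (q (idx x) (pi x))%:E.
have g0 x : D x -> 0 <= g x.
  rewrite -covP' => -[i _ P'x]; rewrite /g (idxE _ _ P'x) lee_fin.
  by have [] := qP i (P'uv _ _ P'x).
have mg : measurable_fun D g.
  rewrite -covP'; apply/measurable_fun_bigcup => // i.
  have [[x0 P'x0]|/set0P/negP/negPn/eqP->] := pselect (P' i !=set0);
    last exact: measurable_fun_set0.
  have [mq _ _ _ _] := qP i (P'uv _ _ P'x0).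
  apply: (eq_measurable_fun (fun x => (q i (pi x))%:E)).
    by move=> x /set_mem P'x; rewrite /g (idxE _ _ P'x).
  apply/measurable_EFinP; apply: (measurableT_comp mq).
  by apply: measurable_funS mpiD.
have gE F : measurable F -> F `<=` D -> mu (psi @` F) = \int[mu]_(x in F) g x.
  move=> mF FD; have FE : F = \bigcup_i (F `&` P' i).
    by rewrite -setI_bigcupr covP'; apply/esym/setIidl.
  have mFP i : measurable (F `&` P' i) by exact: measurableI.
  have tFP : trivIset setT (fun i => F `&` P' i) by exact: trivIset_setIl.
  rewrite [in RHS]FE ge0_integral_bigcup//; last 2 first.
  - by rewrite -FE; exact: measurable_funS mg.
  - by rewrite -FE => x /FD/g0.
  rewrite [in LHS]FE image_bigcup measure_bigcup//=; last 2 first.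
  - by move=> i _; apply: psiM => // x [/FD].
  - apply/trivIsetP => i j _ _ ij; apply/seteqP; split => // _ [[x [Fx P'x] <-]].
    move=> [z [Fz P'z] zx]; move/eqP : ij; apply; apply: (tP' _ _ I I); exists x.
    have zxE : z = x by apply: psiI => //; apply/mem_set; exact: FD.
    by split => //; rewrite -zxE.
  transitivity (\sum_(0 <= i <oo) mu (psi @` (F `&` P' i))).
    by apply: eq_eseriesl => i; rewrite in_setT.
  apply: eq_eseriesr => i _.
  have [[x0 P'x0]|/set0P/negP/negPn/eqP->] := pselect (P' i !=set0); last first.
    by rewrite setI0 image_set0 measure0 integral_set0.
  have [mq q0 qD qE _] := qP i (P'uv _ _ P'x0).
  rewrite (lift_piece (P'uv _ _ P'x0) _ _ _ _ _ mq q0 qD qE)//.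
  - by apply: eq_integral => x /set_mem[_ P'x]; rewrite /g (idxE _ _ P'x).
  - by apply: psiM => // x [/FD].
  - by move=> x [/FD/DX].
  - by move=> x z /set_mem[/FD Dx _] /set_mem[/FD Dz _]; apply: psiI; exact: mem_set.
  - by move=> x [/FD Dx /P'P[_ _ ux ox]]; split => //; exact/EX/psiDE.
exists g.
  split => //; apply/integrableP; split => //.
  (* The integral of [g] over [D] is the mass of the image of [D], hence at most 1. *)
  under eq_integral => x /set_mem Dx do rewrite gee0_abs ?g0//.
  rewrite -gE// (le_lt_trans (probability_le1 _ _)) ?ltry//.
  exact: psiM.
(* The exceptional set of each density is null for [nu], so its preimage is null for [mu]. *)
have negq i : mu.-negligible (X `&` pi @^-1` [set y | [/\ size (uv i).1 = size (uv i).2,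
    exchangeable Y (uv i).1 (uv i).2 y &
    q i y <> expR (potential_cocycle f y (overlay (uv i).2 y))]]).
  apply: lift_negligible; have [suv|nsuv] := pselect (size (uv i).1 = size (uv i).2).
    have [_ _ _ _] := qP i suv; apply: negligibleS => y [_ ? ?]; by split.
  by exists set0; split => // y [].
apply: negligibleS (negligible_bigcup negq) => x /= /not_implyP[Dx gx].
move: (Dx); rewrite -covP' => -[i _ P'x]; exists i => //; split; first exact: DX.
have [_ suv ux ox] := P'P _ _ P'x; split => //=.
  by split => //; [exact/piY/DX|rewrite -ox; exact/piY/EX/psiDE].
(* On this piece the rewriting takes [pi x] to [pi (psi x)], and the cocycle of [f \o pi] is that of
   [f] read through [pi]. *)
move=> qx; apply: gx; rewrite /g (idxE _ _ P'x) qx -ox.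
rewrite (potential_cocycle_code shiftX shift_pi)//; first exact: DX.
exact/EX/psiDE.
Qed.

End LiftedGibbs.

End LiftedMeasure.

End Lift.

(** * Existence of an invariant Gibbs lift *)

Theorem corollary4p12 (R : realType) (A B : alphabetType)
    (X : set (full_shift A)) (Y : set (full_shift B))
    (pi : full_shift A -> full_shift B) (f : full_shift B -> R)
    (nu : probability (full_shift B) R)
    (sftX : shift_of_finite_type X) (irrX : irreducible_shift X)
    (soficY : sofic_shift Y) (irrY : irreducible_shift Y)
    (factor_pi : factor_code X Y pi) (fin_pi : finite_to_one X Y pi)
    (SVf : summable_variation Y f)
    (inv_nu : shift_invariant nu) (gibbs_nu : gibbs_measure_for Y f nu) :
  exists mu : probability (full_shift A) R,
    [/\ shift_invariant mu,
        gibbs_measure_for X (f \o pi) mu &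
        pushes_to X pi mu nu].
Proof.
have [shiftX _] := sftX; have [shiftY _] := soficY.
have [cont_pi image_pi shift_pi] := factor_pi.
have [nuY nonsing_nu _] := gibbs_nu.
(* Fibres over points outside [Y] are empty, so finiteness holds over the whole full shift, where
   the counts are defined. *)
have finite_fibre y : finite_set (X `&` pi @^-1` [set y]).
  have [/fin_pi//|nYy] := pselect (Y y).
  rewrite (_ : _ `&` _ = set0)//; apply/seteqP; split => // x [Xx xy].
  by apply: nYy; rewrite -xy -image_pi; exists x.
have [mu muE] := lift_exists shiftX shiftY cont_pi image_pi finite_fibre nuY.
exists mu; split.
- exact: (lift_shift_invariant shiftX cont_pi shift_pi finite_fibre inv_nu muE).
- exact: (lift_gibbs shiftX shiftY cont_pi image_pi shift_pi finite_fibre nuY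
    inv_nu nonsing_nu muE gibbs_nu).
- exact: (lift_pushes_to shiftY image_pi finite_fibre nuY muE).
Qed.
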